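(* Let $(H,\alpha)$ be an involutive monoidal Hom-Hopf algebra and $(L,[\,,],\beta)$ an involutive braided Hom-Lie algebra in ${}^{H}_{H}\mathcal{HYD}$. Then the universal enveloping algebra $U(L)$, with its monoidal Hom-Hopf algebra structure in ${}^{H}_{H}\mathcal{HYD}$ whose comultiplication $\Delta$ satisfies $\Delta(1)=1\otimes 1$ and $\Delta(\overline l)=\beta_T(\overline l)\otimes1+1\otimes\beta_T(\overline l)$ for $l\in L$, is $H$-cocommutative.
   Context: Everything is over a field $k$; Sweedler-type notation (summation suppressed) is used. Basic objects are pairs $(X,\alpha_X)$ of a $k$-vector space and a linear automorphism; morphisms are linear maps commuting with the automorphisms; $(X,\alpha_X)\otimes(Y,\alpha_Y)=(X\otimes Y,\alpha_X\otimes\alpha_Y)$, with associativity constraint $(x\otimes y)\otimes z\mapsto\alpha_X(x)\otimes(y\otimes\alpha_Z^{-1}(z))$ and unit object $(k,\mathrm{id})$. Involutive means that the structure automorphism squares to the identity. Monoidal Hom-algebra $(A,\beta)$: a pair with a multiplication and $1_A\in A$ such that $\beta(a)(bc)=(ab)\beta(c)$, $\beta(ab)=\beta(a)\beta(b)$, $a1_A=1_Aa=\beta(a)$, $\beta(1_A)=1_A$. Monoidal Hom-coalgebra $(C,\gamma)$: a pair with $\Delta(c)=c_1\otimes c_2$ and $\epsilon$ such that $\gamma^{-1}(c_1)\otimes\Delta(c_2)=\Delta(c_1)\otimes\gamma^{-1}(c_2)$, $\Delta(\gamma(c))=\gamma(c_1)\otimes\gamma(c_2)$, $c_1\epsilon(c_2)=\epsilon(c_1)c_2=\gamma^{-1}(c)$,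 $\epsilon(\gamma(c))=\epsilon(c)$. Monoidal Hom-Hopf algebra $(H,\alpha)$: both structures (with the same $\alpha$), $\Delta$ and $\epsilon$ multiplicative and unital, and an antipode $S$ with $S\alpha=\alpha S$, $S(h_1)h_2=\epsilon(h)1_H=h_1S(h_2)$. An object $(M,\mu)$ of ${}^{H}_{H}\mathcal{HYD}$ (left-left Hom-Yetter-Drinfeld module) is a pair with a left action satisfying $\alpha(h)\cdot(g\cdot m)=(hg)\cdot\mu(m)$, $1_H\cdot m=\mu(m)$, $\mu(h\cdot m)=\alpha(h)\cdot\mu(m)$, and a left coaction $\rho(m)=m_{(-1)}\otimes m_0\in H\otimes M$ satisfying $\Delta(m_{(-1)})\otimes\mu^{-1}(m_0)=\alpha^{-1}(m_{(-1)})\otimes(m_{0(-1)}\otimes m_{00})$, $\rho(\mu(m))=\alpha(m_{(-1)})\otimes\mu(m_0)$, $\epsilon(m_{(-1)})m_0=\mu^{-1}(m)$, and $\rho(h\cdot m)=(h_{11}\alpha^{-1}(m_{(-1)}))S(h_2)\otimes\alpha(h_{12})\cdot m_0$. Morphisms are $H$-linear, $H$-colinear maps commuting with the structure automorphisms. Tensor products carry $h\cdot(m\otimes n)=h_1\cdot m\otimes h_2\cdot n$ and $\rho(m\otimes n)=m_{(-1)}n_{(-1)}\otimes(m_0\otimes n_0)$. The braiding is $C_{M,N}(m\otimes n)=m_{(-1)}\cdot\nu^{-1}(n)\otimes\mu(m_0)$ for $(M,\mu),(N,\nu)$. A coalgebra $(A,\beta)$ in ${}^{H}_{H}\mathcal{HYD}$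 is $H$-cocommutative if $C_{A,A}\circ\Delta=\Delta$, i.e. $a_{1(-1)}\cdot\beta^{-1}(a_2)\otimes\beta(a_{10})=a_1\otimes a_2$ for all $a\in A$. A monoidal Hom-algebra in ${}^{H}_{H}\mathcal{HYD}$ is an object that is a monoidal Hom-algebra whose multiplication and unit are morphisms ($h\cdot(ab)=(h_1\cdot a)(h_2\cdot b)$, $h\cdot1=\epsilon(h)1$, $\rho(ab)=a_{(-1)}b_{(-1)}\otimes a_0b_0$, $\rho(1)=1_H\otimes1$). A monoidal Hom-Hopf algebra in ${}^{H}_{H}\mathcal{HYD}$ is a monoidal Hom-algebra $(A,\beta)$ in ${}^{H}_{H}\mathcal{HYD}$ that is also a monoidal Hom-coalgebra (with the same $\beta$) whose $\Delta,\epsilon$ are morphisms in ${}^{H}_{H}\mathcal{HYD}$, are unital and multiplicative for the product $(a\otimes b)(a'\otimes b')=a(b_{(-1)}\cdot\beta^{-1}(a'))\otimes\beta(b_0)b'$ on $A\otimes A$, and that has an antipode $S:A\to A$, a morphism in ${}^{H}_{H}\mathcal{HYD}$ with $S(a_1)a_2=\epsilon(a)1=a_1S(a_2)$. A braided Hom-Lie algebra is a triple $(L,[\,,],\beta)$ where $L$ is an object of ${}^{H}_{H}\mathcal{HYD}$ (with structure automorphism $\beta$), $\beta:L\to L$ is a homomorphism in ${}^{H}_{H}\mathcal{HYD}$, and $[\,,]:L\otimes L\to L$ is a morphism in ${}^{H}_{H}\mathcal{HYD}$ with (i) $[l,l']=-[l_{(-1)}\cdot\beta^{-1}(l'),\beta(l_0)]$;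 (ii) $\{l\otimes l'\otimes l''\}+\{(C\otimes1)(1\otimes C)(l\otimes l'\otimes l'')\}+\{(1\otimes C)(C\otimes1)(l\otimes l'\otimes l'')\}=0$ for all $l,l',l''\in L$, where $\{l\otimes l'\otimes l''\}=[\beta(l),[l',l'']]$ and $C$ is the braiding for $L$. $T(L)=\bigoplus_{i\geq0}L^{\otimes i}$, with $L^{\otimes0}=k$ (trivial structure), an object of ${}^{H}_{H}\mathcal{HYD}$; $\beta_T$ is $\beta^{\otimes i}$ on $L^{\otimes i}$ (identity on $k$); the product is $(x_1\otimes\cdots\otimes x_i)\odot(y_1\otimes\cdots\otimes y_j)=\beta_T^{j-1}(x_1\otimes\cdots\otimes x_i)\otimes y_1\otimes\beta_T(y_2\otimes\cdots\otimes y_j)$ for $i,j\geq1$, and $1\odot x=x\odot1=\beta_T(x)$. $U(L)=T(L)/I$, where $I$ is the $H$-Hom-ideal generated by all $x\otimes y-(x_{(-1)}\cdot\beta(y))\otimes\beta(x_0)-[x,y]$, $x,y\in L$; an $H$-Hom-ideal $U$ of $A$ is a subspace with $H\cdot U\subseteq U$, $\rho(U)\subseteq H\otimes U$, $\beta(U)\subseteq U$, $(AU)A=A(UA)\subseteq U$. The induced automorphism of $U(L)$ is still written $\beta_T$; $\overline l$ is the image of $l\in L$ in $U(L)$. The monoidal Hom-Hopf algebra structure on $U(L)$ in ${}^{H}_{H}\mathcal{HYD}$ is the one with the indicated $\Delta$, with $\epsilon(\overline l)=0$, $\epsilon(1)=1$, $S(\overline l)=-\overline l$ for $l\in L$, and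 $S(\overline x\,\overline y)=(\overline x_{(-1)}\cdot S(\beta_T^{-1}(\overline y)))S(\beta_T(\overline x_0))$ for $\overline x,\overline y\in U(L)$. *)

(* Defs.v *)
From HB Require Import structures.
From mathcomp Require Import all_boot all_order all_algebra.
From mathcomp Require Import boolp.

Set Implicit Arguments.
Unset Strict Implicit.
Unset Printing Implicit Defensive.

Import GRing.Theory.
Local Open Scope ring_scope.
Local Open Scope quotient_scope.

Notation bilin f := (bilinear_for *:%R *:%R f).

(* V ⊗ W is the set of formal sums of pairs (v, w), two formal sums being
   identified when every bilinear map out of V x W takes the same value on
   them: this is the universal property of the tensor product (see [swE],
   [sw_linear] and [tens_sum] below). *)
Section Tensor.
Variables (k : fieldType) (V W : lmodType k).

Definition fsum (U : lmodType k) (f : V -> W -> U) (s : seq (V * W)) : U :=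
  \sum_(p <- s) f p.1 p.2.

Definition tens_eq (s t : seq (V * W)) : bool :=
  `[< forall (U : lmodType k) (f : V -> W -> U), bilin f ->
        fsum f s = fsum f t >].

Lemma tens_eqP s t :
  reflect (forall (U : lmodType k) (f : V -> W -> U), bilin f ->
             fsum f s = fsum f t) (tens_eq s t).
Proof. exact: asboolP. Qed.

Lemma tens_eq_equiv : equiv_class_of tens_eq.
Proof.
split=> [s|s t|t s u].
- exact/tens_eqP.
- by apply/tens_eqP/tens_eqP => h U f fb; rewrite h.
- move=> /tens_eqP h1 /tens_eqP h2; apply/tens_eqP => U f fb.
  by rewrite h1 // h2.
Qed.

Canonical tens_equiv := EquivRelPack tens_eq_equiv.
Canonical tens_encModRel := defaultEncModRel tens_eq.

Definition tens := {eq_quot tens_eq}.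
HB.instance Definition _ := EqQuotient.on tens.
HB.instance Definition _ := Choice.on tens.

Implicit Types (s t : seq (V * W)) (x y z : tens).

Definition tclass s : tens := \pi_tens s.

(* the Sweedler sum of a tensor x = sum of v ⊗ w, i.e. the sum of the f v w *)
Definition sw (U : lmodType k) (x : tens) (f : V -> W -> U) : U :=
  fsum f (repr x).

Definition pure v w : tens := tclass [:: (v, w)].

Lemma tclassP s t :
  tclass s = tclass t <-> (forall (U : lmodType k) (f : V -> W -> U),
     bilin f -> fsum f s = fsum f t).
Proof.
split; first by move=> /eqmodP /tens_eqP.
by move=> h; apply/eqmodP/tens_eqP.
Qed.

Lemma sw_tclass (U : lmodType k) s (f : V -> W -> U) :
  bilin f -> sw (tclass s) f = fsum f s.
Proof.
move=> fb; have h : tclass (repr (tclass s)) = tclass s by exact: reprK.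
exact: (iffLR (tclassP _ _) h).
Qed.

Lemma sw_inj x y :
  (forall (U : lmodType k) (f : V -> W -> U), bilin f -> sw x f = sw y f) ->
  x = y.
Proof. by move=> h; rewrite -[x]reprK -[y]reprK; apply/(iffRL (tclassP _ _)) => U f /h. Qed.

Definition zscale (a : k) s := [seq (a *: p.1, p.2) | p <- s].

Definition tzero : tens := tclass [::].
Definition tadd x y : tens := tclass (repr x ++ repr y).
Definition tscale a x : tens := tclass (zscale a (repr x)).
Definition topp x : tens := tscale (- 1) x.

Section Sw.
Variables (U : lmodType k) (f : V -> W -> U).
Hypothesis fb : bilin f.

Lemma bilZl a v w : f (a *: v) w = a *: f v w.
Proof. by have := fb.1 w; move=> /scalable_linear ->. Qed.

Lemma sw_tzero : sw tzero f = 0.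
Proof. by rewrite sw_tclass // /fsum big_nil. Qed.

Lemma sw_tadd x y : sw (tadd x y) f = sw x f + sw y f.
Proof. by rewrite sw_tclass // /fsum big_cat. Qed.

Lemma sw_tscale a x : sw (tscale a x) f = a *: sw x f.
Proof.
rewrite sw_tclass // /fsum big_map scaler_sumr.
by apply: eq_bigr => p _ /=; rewrite bilZl.
Qed.

Definition swE' := (sw_tzero, sw_tadd, sw_tscale).
End Sw.

Fact taddA : associative tadd.
Proof. by move=> x y z; apply: sw_inj => U f fb; rewrite !swE' // addrA. Qed.

Fact taddC : commutative tadd.
Proof. by move=> x y; apply: sw_inj => U f fb; rewrite !swE' // addrC. Qed.

Fact tadd0 : left_id tzero tadd.
Proof. by move=> x; apply: sw_inj => U f fb; rewrite !swE' // add0r. Qed.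

Fact taddN : left_inverse tzero topp tadd.
Proof.
by move=> x; apply: sw_inj => U f fb; rewrite !swE' // scaleN1r addNr.
Qed.

HB.instance Definition _ := GRing.isZmodule.Build tens taddA taddC tadd0 taddN.

Fact tscaleA a b x : tscale a (tscale b x) = tscale (a * b) x.
Proof. by apply: sw_inj => U f fb; rewrite !swE' // scalerA. Qed.

Fact tscale1 : left_id 1 tscale.
Proof. by move=> x; apply: sw_inj => U f fb; rewrite !swE' // scale1r. Qed.

Fact tscaleDr : right_distributive tscale +%R.
Proof.
move=> a x y; apply: sw_inj => U f fb; rewrite -[x + y]/(tadd x y).
by rewrite -[_ + tscale _ _]/(tadd _ _) !swE' // scalerDr.
Qed.

Fact tscaleDl x : {morph tscale^~ x : a b / a + b}.
Proof.
move=> a b; apply: sw_inj => U f fb.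
by rewrite -[_ + tscale _ _]/(tadd _ _) !swE' // scalerDl.
Qed.

HB.instance Definition _ := GRing.Zmodule_isLmodule.Build k tens
  tscaleA tscale1 tscaleDr tscaleDl.

End Tensor.

Arguments sw {k V W U} x f.
Arguments pure {k V W} v w.

Notation "V ⊗ W" := (tens V%type W%type) (at level 40, left associativity) : type_scope.
Notation "v ⊗ w" := (pure v w) (at level 40, left associativity) : ring_scope.
Notation "\sw_ ( a , b <- t ) F" := (sw t (fun a b => F))
  (at level 41, a name, b name, t at level 36, F at level 41) : ring_scope.

Section TensorTheory.
Variables (k : fieldType) (V W : lmodType k).

Lemma swE (U : lmodType k) (f : V -> W -> U) :
  bilin f -> forall v w, \sw_(a, b <- v ⊗ w) f a b = f v w.
Proof. by move=> fb v w; rewrite sw_tclass // /fsum big_seq1. Qed.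

Lemma sw_linear (U : lmodType k) (f : V -> W -> U) :
  bilin f -> linear (fun t : V ⊗ W => sw t f).
Proof. by move=> fb a x y /=; rewrite sw_tadd // sw_tscale. Qed.

Lemma pure_bilin : bilin (fun (v : V) (w : W) => v ⊗ w).
Proof.
have key (U : lmodType k) (f : V -> W -> U) (fb : bilin f) v w :
  sw (v ⊗ w) f = f v w by exact: swE.
split=> [w a v v'|v a w w'] /=; apply: sw_inj => U f fb.
  by rewrite (sw_linear fb) !key // fb.1.
by rewrite (sw_linear fb) !key // fb.2.
Qed.

Lemma tens_sum (t : V ⊗ W) : t = \sw_(v, w <- t) (v ⊗ w).
Proof.
apply: sw_inj => U f fb; rewrite {2}/sw /fsum.
have -> : sw t f = \sum_(p <- repr t) sw (p.1 ⊗ p.2) f.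
  by apply: eq_bigr => p _; rewrite swE.
have hD x y : sw (x + y) f = sw x f + sw y f by exact: sw_tadd.
have h0 : sw 0 f = 0 by exact: sw_tzero.
by rewrite -(big_morph (fun x => sw x f) hD h0).
Qed.

End TensorTheory.

Section TensorMaps.
Variable k : fieldType.
Implicit Types V W X : lmodType k.

Definition tmap V W V' W' (f : V -> V') (g : W -> W') (t : V ⊗ W) : V' ⊗ W' :=
  \sw_(v, w <- t) (f v ⊗ g w).

(* the plain reassociation of triple tensors, which is not the associativity
   constraint of the category of Hom-objects *)
Definition tassoc V W X (t : (V ⊗ W) ⊗ X) : V ⊗ (W ⊗ X) :=
  \sw_(p, x <- t) \sw_(v, w <- p) (v ⊗ (w ⊗ x)).

Definition tassocV V W X (t : V ⊗ (W ⊗ X)) : (V ⊗ W) ⊗ X :=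
  \sw_(v, p <- t) \sw_(w, x <- p) (v ⊗ w ⊗ x).

(* t lies in the subspace V ⊗ P of V ⊗ W *)
Definition in_right V W (P : {pred W}) (t : V ⊗ W) : Prop :=
  exists s : seq (V * W),
    (forall p, p \in s -> p.2 \in P) /\ t = \sum_(p <- s) (p.1 ⊗ p.2).

End TensorMaps.

Section DirectSum.
Variables (k : fieldType) (V : nat -> lmodType k).

Record dsum := DSum {
  dcoef :> forall n, V n;
  dfin : exists N, forall n, (N <= n)%N -> dcoef n = 0 }.

HB.instance Definition _ := gen_eqMixin dsum.
HB.instance Definition _ := gen_choiceMixin dsum.

Lemma dsumP (x y : dsum) : (forall n, x n = y n) -> x = y.
Proof.
case: x y => [x px] [y py] /= h; have e : x = y by exact: functional_extensionality_dep.
by case: y / e py {h} => py; congr DSum; exact: Prop_irrelevance.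
Qed.

Fact dzero_fin : exists N, forall n, (N <= n)%N -> (0 : V n) = 0.
Proof. by exists 0%N. Qed.
Definition dzero := DSum dzero_fin.

Fact dadd_fin (x y : dsum) :
  exists N, forall n, (N <= n)%N -> x n + y n = 0.
Proof.
have [[N hN] [M hM]] := (dfin x, dfin y); exists (maxn N M) => n.
by rewrite geq_max => /andP[/hN -> /hM ->]; rewrite addr0.
Qed.
Definition dadd x y := DSum (dadd_fin x y).

Fact dscale_fin a (x : dsum) : exists N, forall n, (N <= n)%N -> a *: x n = 0.
Proof. by have [N hN] := dfin x; exists N => n /hN ->; rewrite scaler0. Qed.
Definition dscale a x := DSum (dscale_fin a x).

Fact dopp_fin (x : dsum) : exists N, forall n, (N <= n)%N -> - x n = 0.
Proof. by have [N hN] := dfin x; exists N => n /hN ->; rewrite oppr0. Qed.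
Definition dopp x := DSum (dopp_fin x).

Fact daddA : associative dadd.
Proof. by move=> x y z; apply: dsumP => n /=; rewrite addrA. Qed.
Fact daddC : commutative dadd.
Proof. by move=> x y; apply: dsumP => n /=; rewrite addrC. Qed.
Fact dadd0 : left_id dzero dadd.
Proof. by move=> x; apply: dsumP => n /=; rewrite add0r. Qed.
Fact daddN : left_inverse dzero dopp dadd.
Proof. by move=> x; apply: dsumP => n /=; rewrite addNr. Qed.

HB.instance Definition _ := GRing.isZmodule.Build dsum daddA daddC dadd0 daddN.

Fact dscaleA a b x : dscale a (dscale b x) = dscale (a * b) x.
Proof. by apply: dsumP => n /=; rewrite scalerA. Qed.
Fact dscale1 : left_id 1 dscale.
Proof. by move=> x; apply: dsumP => n /=; rewrite scale1r. Qed.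
Fact dscaleDr : right_distributive dscale +%R.
Proof. by move=> a x y; apply: dsumP => n /=; rewrite scalerDr. Qed.
Fact dscaleDl x : {morph dscale^~ x : a b / a + b}.
Proof. by move=> a b; apply: dsumP => n /=; rewrite scalerDl. Qed.

HB.instance Definition _ := GRing.Zmodule_isLmodule.Build k dsum
  dscaleA dscale1 dscaleDr dscaleDl.

Definition din_coef n (v : V n) m : V m :=
  match @eqP _ n m with
  | ReflectT e => ecast m (V m) e v
  | ReflectF _ => 0
  end.

Fact din_fin n (v : V n) :
  exists N, forall m, (N <= m)%N -> din_coef v m = 0.
Proof.
exists n.+1 => m lt_nm; rewrite /din_coef; case: eqP => // e.
by rewrite e ltnn in lt_nm.
Qed.

Definition din n (v : V n) : dsum := DSum (din_fin v).

Definition dbound (x : dsum) : nat := projT1 (cid (dfin x)).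

(* the map out of the direct sum with components F n; by [dliftE] the choice
   of the bound is irrelevant as soon as the F n vanish at 0 *)
Definition dlift (U : lmodType k) (x : dsum) (F : forall n, V n -> U) : U :=
  \sum_(n < dbound x) F n (x n).

Lemma dliftE (U : lmodType k) (x : dsum) (F : forall n, V n -> U) N :
  (forall n, F n 0 = 0) -> (forall n, (N <= n)%N -> x n = 0) ->
  dlift x F = \sum_(n < N) F n (x n).
Proof.
move=> F0 xN; rewrite /dlift /dbound; case: cid => M /= xM.
rewrite -!(big_mkord xpredT (fun n => F n (x n))).
have [leNM|/ltnW leMN] := leqP N M.
  rewrite (big_cat_nat (leq0n N) leNM) /= [X in _ + X]big_nat [X in _ + X]big1 ?addr0 //.
  by move=> n /andP[/xN -> _].
rewrite (big_cat_nat (leq0n M) leMN) /= [X in _ + X]big_nat [X in _ + X]big1 ?addr0 //.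
by move=> n /andP[/xM -> _].
Qed.

Lemma din_id n (v : V n) : din v n = v.
Proof.
by rewrite /= /din_coef; case: eqP => // e; rewrite eq_axiomK.
Qed.

Lemma din_neq n m (v : V n) : n != m -> din v m = 0.
Proof. by rewrite /= /din_coef; case: eqP => // -> /negP. Qed.

Lemma dlift_din (U : lmodType k) (F : forall n, V n -> U) n (v : V n) :
  (forall n, F n 0 = 0) -> dlift (din v) F = F n v.
Proof.
move=> F0; rewrite (@dliftE _ _ _ n.+1) //; last first.
  by move=> m ltnm; rewrite din_neq // neq_ltn ltnm.
rewrite big_ord_recr /= big1 ?add0r; last first.
  move=> i _; rewrite -[din_coef _ _]/(din v i) din_neq ?F0 //.
  by rewrite neq_ltn ltn_ord orbT.
by rewrite -[din_coef _ _]/(din v n) din_id.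
Qed.

End DirectSum.

Section QuotientSpace.
Variables (k : fieldType) (V : lmodType k) (P : submodClosed V).

Definition zpred : {pred V} := [pred v | v \in P].

Fact zpred_closed : zmod_closed zpred.
Proof.
split=> [|x y]; rewrite !inE ?rpred0 // => Px Py.
by rewrite rpredD // -scaleN1r rpredZ.
Qed.
HB.instance Definition _ := GRing.isZmodClosed.Build V zpred zpred_closed.

Definition qspace := Quotient.quot zpred.
HB.instance Definition _ := GRing.Zmodule.on qspace.

Definition qproj (v : V) : qspace := \pi_(Quotient.quot zpred) v.

Lemma qprojP u v : qproj u = qproj v <-> u - v \in P.
Proof.
split=> [e|uv]; first by rewrite -[_ \in P]/(u - v \in zpred) Quotient.idealrBE; apply/eqP.
by apply/eqP; rewrite /qproj -Quotient.idealrBE.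
Qed.

Lemma qproj_surj (u : qspace) : qproj (repr u) = u.
Proof. exact: reprK. Qed.

Lemma qprojD : {morph qproj : u v / u + v}.
Proof. by move=> u v; rewrite /qproj piE. Qed.

Definition qscale (a : k) (u : qspace) : qspace := qproj (a *: repr u).

Lemma qscale_pi a v : qscale a (qproj v) = qproj (a *: v).
Proof. by apply/qprojP; rewrite -scalerBr rpredZ //; apply/qprojP; rewrite qproj_surj. Qed.

Fact qscaleA a b u : qscale a (qscale b u) = qscale (a * b) u.
Proof. by rewrite -[u]qproj_surj !qscale_pi scalerA. Qed.
Fact qscale1 : left_id 1 qscale.
Proof. by move=> u; rewrite -[u]qproj_surj !qscale_pi scale1r. Qed.
Fact qscaleDr : right_distributive qscale +%R.
Proof.
move=> a u v; rewrite -[u]qproj_surj -[v]qproj_surj.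
by rewrite -qprojD !qscale_pi scalerDr qprojD.
Qed.
Fact qscaleDl u : {morph qscale^~ u : a b / a + b}.
Proof. by move=> a b; rewrite -[u]qproj_surj !qscale_pi scalerDl qprojD. Qed.

HB.instance Definition _ := GRing.Zmodule_isLmodule.Build k qspace
  qscaleA qscale1 qscaleDr qscaleDl.

Lemma qproj_linear : linear qproj.
Proof. by move=> a u v; rewrite qprojD -qscale_pi. Qed.

End QuotientSpace.

(* Each structure consists of a record holding the operations and of a
   predicate holding the axioms, so that operations on a constructed space
   (tensor powers, T(L), U(L)) can be given before any axiom is known to hold. *)

Record homObj (k : fieldType) := HomObj {
  hcar :> lmodType k;
  haut : hcar -> hcar;
  hautV : hcar -> hcar }.
Arguments haut {k} X x : rename.
Arguments hautV {k} X x : rename.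

Section HomStructures.
Variable k : fieldType.

Definition is_homObj (X : homObj k) : Prop :=
  [/\ linear (haut X), cancel (haut X) (hautV X)
    & cancel (hautV X) (haut X)].

Definition hom_unit : homObj k := HomObj (hcar := k^o) id id.

Definition hom_tens (X Y : homObj k) : homObj k :=
  HomObj (hcar := (X ⊗ Y)%type) (tmap (haut X) (haut Y)) (tmap (hautV X) (hautV Y)).

Definition is_homAlg (A : homObj k) (mul : A -> A -> A) (one : A) : Prop :=
  [/\ bilin mul,
      forall a b c, mul (haut A a) (mul b c) = mul (mul a b) (haut A c),
      forall a b, haut A (mul a b) = mul (haut A a) (haut A b),
      forall a, mul a one = haut A a /\ mul one a = haut A a
    & haut A one = one].

Definition is_homCoalg (C : homObj k) (comul : C -> C ⊗ C) (counit : C -> k) :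
    Prop :=
  [/\ linear comul /\ linear (counit : C -> k^o),
      forall c, tmap (hautV C) comul (comul c)
                = tassoc (tmap comul (hautV C) (comul c)),
      forall c, comul (haut C c) = tmap (haut C) (haut C) (comul c),
      forall c, \sw_(c1, c2 <- comul c) (counit c2 *: c1) = hautV C c
             /\ \sw_(c1, c2 <- comul c) (counit c1 *: c2) = hautV C c
    & forall c, counit (haut C c) = counit c].

Record homHopf := HomHopf {
  hobj :> homObj k;
  hmul : hobj -> hobj -> hobj;
  hone : hobj;
  hcomul : hobj -> hobj ⊗ hobj;
  hcounit : hobj -> k;
  hanti : hobj -> hobj }.

Definition is_homHopf (H : homHopf) : Prop :=
  [/\ is_homObj H, is_homAlg (@hmul H) (hone H),
      is_homCoalg (@hcomul H) (@hcounit H),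
      [/\ forall h g : H, hcomul (hmul h g)
            = \sw_(h1, h2 <- hcomul h) \sw_(g1, g2 <- hcomul g)
                (hmul h1 g1 ⊗ hmul h2 g2),
          hcomul (hone H) = hone H ⊗ hone H,
          forall h g : H, hcounit (hmul h g) = hcounit h * hcounit g
        & hcounit (hone H) = 1]
    & [/\ linear (@hanti H),
          forall h : H, hanti (haut H h) = haut H (hanti h),
          forall h : H, \sw_(h1, h2 <- hcomul h) hmul (hanti h1) h2
            = hcounit h *: hone H
        & forall h : H, \sw_(h1, h2 <- hcomul h) hmul h1 (hanti h2)
            = hcounit h *: hone H]].

End HomStructures.

Section YetterDrinfeld.
Variables (k : fieldType) (H : homHopf k).

Record hyd := Hyd {
  yobj :> homObj k;
  act : H -> yobj -> yobj;
  coact : yobj -> H ⊗ yobj }.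

Definition is_hyd (M : hyd) : Prop :=
  [/\ is_homObj M,
      [/\ bilin (@act M),
          forall (h g : H) (m : M),
            act (haut H h) (act g m) = act (hmul h g) (haut M m),
          forall m : M, act (hone H) m = haut M m
        & forall (h : H) (m : M),
            haut M (act h m) = act (haut H h) (haut M m)],
      [/\ linear (@coact M),
          forall m : M, tassoc (tmap (@hcomul k H) (hautV M) (coact m))
            = tmap (hautV H) (@coact M) (coact m),
          forall m : M, coact (haut M m) = tmap (haut H) (haut M) (coact m)
        & forall m : M, \sw_(m1, m0 <- coact m) (hcounit m1 *: m0) = hautV M m]
    & forall (h : H) (m : M), coact (act h m)
        = \sw_(h1, h2 <- hcomul h) \sw_(h11, h12 <- hcomul h1)
          \sw_(m1, m0 <- coact m)
            (hmul (hmul h11 (hautV H m1)) (hanti h2) ⊗ act (haut H h12) m0)].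

Definition hyd_morphism (M N : hyd) (f : M -> N) : Prop :=
  [/\ linear f,
      forall m, f (haut M m) = haut N (f m),
      forall h m, f (act h m) = act h (f m)
    & forall m, coact (f m) = tmap id f (coact m)].

Definition hyd_unit : hyd :=
  Hyd (yobj := hom_unit k) (fun h c => hcounit h * c) (fun c => hone H ⊗ c).

Definition hyd_tens (M N : hyd) : hyd :=
  Hyd (yobj := hom_tens M N)
    (fun h t => \sw_(h1, h2 <- hcomul h) tmap (@act M h1) (@act N h2) t)
    (fun t => \sw_(m, n <- t) \sw_(m1, m0 <- coact m) \sw_(n1, n0 <- coact n)
                (hmul m1 n1 ⊗ (m0 ⊗ n0))).

Definition braid (M N : hyd) (t : M ⊗ N) : N ⊗ M :=
  \sw_(m, n <- t) \sw_(m1, m0 <- coact m) (act m1 (hautV N n) ⊗ haut M m0).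

Definition H_cocommutative (A : hyd) (comul : A -> A ⊗ A) : Prop :=
  forall a, braid (comul a) = comul a.

Definition is_hydAlg (A : hyd) (mul : A -> A -> A) (one : A) : Prop :=
  [/\ is_hyd A, is_homAlg mul one,
      @hyd_morphism (hyd_tens A A) A (fun t => \sw_(a, b <- t) mul a b)
    & @hyd_morphism hyd_unit A (fun c => c *: one)].

(* the product of the braided tensor product of A with itself *)
Definition braid_mul (A : hyd) (mul : A -> A -> A) (s t : A ⊗ A) : A ⊗ A :=
  \sw_(a, b <- s) \sw_(a', b' <- t) \sw_(b1, b0 <- coact b)
    (mul a (act b1 (hautV A a')) ⊗ mul (haut A b0) b').

Definition is_hydHopf (A : hyd) (mul : A -> A -> A) (one : A)
    (comul : A -> A ⊗ A) (counit : A -> k) (anti : A -> A) : Prop :=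
  [/\ is_hydAlg mul one,
      [/\ is_homCoalg comul counit,
          @hyd_morphism A (hyd_tens A A) comul
        & @hyd_morphism A hyd_unit counit],
      [/\ forall a b, comul (mul a b) = braid_mul mul (comul a) (comul b),
          comul one = one ⊗ one,
          forall a b, counit (mul a b) = counit a * counit b
        & counit one = 1]
    & [/\ hyd_morphism anti,
          forall a, \sw_(a1, a2 <- comul a) mul (anti a1) a2 = counit a *: one
        & forall a, \sw_(a1, a2 <- comul a) mul a1 (anti a2) = counit a *: one]].

Definition span_mul (A : hyd) (mul : A -> A -> A) (X Y : A -> Prop) (z : A) :
    Prop :=
  exists s : seq (A * A),
    (forall p, p \in s -> X p.1 /\ Y p.2) /\ z = \sum_(p <- s) mul p.1 p.2.

Definition is_HHomIdeal (A : hyd) (mul : A -> A -> A) (P : submodClosed A) :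
    Prop :=
  let full := fun _ : A => True in
  let inP := fun u : A => u \in P in
  [/\ forall (h : H) u, u \in P -> act h u \in P,
      forall u, u \in P -> in_right P (coact u),
      forall u, u \in P -> haut A u \in P,
      forall z, span_mul mul (span_mul mul full inP) full z <->
                span_mul mul full (span_mul mul inP full) z
    & forall z, span_mul mul full (span_mul mul inP full) z -> z \in P].

End YetterDrinfeld.

Arguments act {k H M} h m : rename.
Arguments coact {k H M} m : rename.
Arguments braid {k H M N} t.

Section BraidedHomLie.
Variables (k : fieldType) (H : homHopf k).

Record homLie := HomLie {
  lobj :> hyd H;
  bracket : lobj -> lobj -> lobj }.
Arguments bracket {L} x y : rename.

(* The operators C ⊗ 1 and 1 ⊗ C on L ⊗ L ⊗ L act on adjacent factors, with no
   associativity constraint inserted; for trivial H the Jacobi identity below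
   is then the usual one of Hom-Lie algebras. *)
Definition braid12 (L : homLie) (t : L ⊗ L ⊗ L) : L ⊗ L ⊗ L := tmap braid id t.
Definition braid23 (L : homLie) (t : L ⊗ L ⊗ L) : L ⊗ L ⊗ L :=
  tassocV (tmap id braid (tassoc t)).

Definition jacobiator (L : homLie) (t : L ⊗ L ⊗ L) : L :=
  \sw_(p, z <- t) \sw_(x, y <- p) bracket (haut L x) (bracket y z).

Definition is_homLie (L : homLie) : Prop :=
  [/\ is_hyd L,
      @hyd_morphism k H L L (haut L),
      bilin (@bracket L) /\
      @hyd_morphism k H (hyd_tens L L) L (fun t => \sw_(x, y <- t) bracket x y),
      forall x y : L, bracket x y =
        - \sw_(x1, x0 <- coact x) bracket (act x1 (hautV L y)) (haut L x0)
    & forall x y z : L, let t := x ⊗ y ⊗ z in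
        jacobiator t + jacobiator (braid12 (braid23 t))
          + jacobiator (braid23 (braid12 t)) = 0].

End BraidedHomLie.

Arguments bracket {k H L} x y : rename.

Section Enveloping.
Variables (k : fieldType) (H : homHopf k) (L : homLie H).

(* L^{⊗n}, bracketed to the left *)
Fixpoint tpow (n : nat) : hyd H :=
  match n with
  | 0 => hyd_unit H
  | n'.+1 => match n' with 0 => L | _.+1 => hyd_tens (tpow n') L end
  end.

(* the concatenation (x_1 ⊗ ... ⊗ x_i) ⊗ (y_1 ⊗ ... ⊗ y_j), i, j >= 1 *)
Fixpoint tcat i j (x : tpow i.+1) : tpow j.+1 -> tpow (j.+1 + i.+1) :=
  match j return tpow j.+1 -> tpow (j.+1 + i.+1) with
  | 0 => fun y : L => (x ⊗ y : tpow i.+1 ⊗ L)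
  | j'.+1 => fun y : tpow j'.+1 ⊗ L =>
      (\sw_(y', l <- y) (tcat x y' ⊗ l) : tpow (j'.+1 + i.+1) ⊗ L)
  end.

(* y_1 ⊗ y_2 ⊗ ... ⊗ y_j |-> y_1 ⊗ beta(y_2) ⊗ ... ⊗ beta(y_j), j >= 1 *)
Fixpoint ttwist j : tpow j.+1 -> tpow j.+1 :=
  match j return tpow j.+1 -> tpow j.+1 with
  | 0 => fun y => y
  | j'.+1 => fun y : tpow j'.+1 ⊗ L => tmap (@ttwist j') (haut L) y
  end.

Definition tcar : lmodType k := dsum tpow.

Definition T_obj : hyd H :=
  Hyd (yobj := HomObj (hcar := tcar)
         (fun x => dlift x (fun n v => din (V := tpow) (haut (tpow n) v)))
         (fun x => dlift x (fun n v => din (V := tpow) (hautV (tpow n) v))))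
    (fun h x => dlift x (fun n v => din (V := tpow) (act (M := tpow n) h v)))
    (fun x => dlift x (fun n v =>
       tmap id (@din k tpow n) (coact (M := tpow n) v))).

Definition tprod i j : tpow i -> tpow j -> T_obj :=
  match i, j return tpow i -> tpow j -> T_obj with
  | 0, j => fun (c : k) y => din (V := tpow) (c *: haut (tpow j) y)
  | i, 0 => fun x (c : k) => din (V := tpow) (c *: haut (tpow i) x)
  | i'.+1, j'.+1 => fun x y =>
      din (V := tpow) (tcat (iter j' (haut (tpow i'.+1)) x) (ttwist y))
  end.

Definition T_mul (x y : T_obj) : T_obj :=
  dlift x (fun i v => dlift y (fun j w => tprod v w)).

Definition T_one : T_obj := din (V := tpow) (n := 0) (1 : k^o).

Definition T_incl (l : L) : T_obj := din (V := tpow) (n := 1) l.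

Definition U_rel (x y : L) : T_obj :=
  din (V := tpow) (n := 2)
    (x ⊗ y - \sw_(x1, x0 <- coact x) (act x1 (haut L y) ⊗ haut L x0))
  - T_incl (bracket x y).

Definition U_ideal : {pred T_obj} := [pred u | `[<
  forall P : submodClosed T_obj, is_HHomIdeal T_mul P ->
    (forall x y, U_rel x y \in P) -> u \in P >]].

Fact U_ideal_submod : submod_closed U_ideal.
Proof.
split=> [|a u v]; rewrite !inE; first by apply/asboolP => P _ _; exact: rpred0.
move=> /asboolP hu /asboolP hv; apply/asboolP => P idP relP.
by rewrite rpredD ?rpredZ ?hu ?hv.
Qed.
HB.instance Definition _ :=
  GRing.isSubmodClosed.Build k T_obj U_ideal U_ideal_submod.

Definition ucar : lmodType k := qspace U_ideal.
Definition U_proj : T_obj -> ucar := @qproj k T_obj U_ideal.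

(* the operations induced on the quotient, computed on representatives *)
Definition U_obj : hyd H :=
  Hyd (yobj := HomObj (hcar := ucar)
         (fun u => U_proj (haut T_obj (repr u)))
         (fun u => U_proj (hautV T_obj (repr u))))
    (fun h u => U_proj (act h (repr u : T_obj)))
    (fun u => tmap id U_proj (coact (repr u : T_obj))).

Definition U_mul (u v : U_obj) : U_obj := U_proj (T_mul (repr u) (repr v)).
Definition U_one : U_obj := U_proj T_one.
Definition U_incl (l : L) : U_obj := U_proj (T_incl l).

End Enveloping.

(* Main.v *)
Require Import Defs.
From mathcomp Require Import all_boot all_order all_algebra.
From mathcomp Require Import boolp classical_sets.

Set Implicit Arguments.
Unset Strict Implicit.
Unset Printing Implicit Defensive.

Import GRing.Theory.
Local Open Scope ring_scope.

(* Write C for the braiding of U(L); all structure automorphisms are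
   involutions.  Applying the multiplicative map Delta to the defining relation
   x y = m(C(x ⊗ y)) + [x, y] leaves, once the terms in 1 ⊗ U(L) and U(L) ⊗ 1
   are cancelled, C(C(x ⊗ y)) = x ⊗ y for x, y in L.  The hexagon identities
   propagate this from generators to products, so that C is an involution of
   U(L) ⊗ U(L).  For l in L, right multiplication of t = Delta(a) by Delta(l)
   is the sum of two operators X_l t + Y_l t with C Y_l = X_l C, so C t = t
   gives C(Y_l t) = X_l t and C(X_l t) = C(C(Y_l t)) = Y_l t: the elements a
   with C(Delta(a)) = Delta(a) are stable under right multiplication by l,
   and therefore exhaust U(L). *)

(** * Linear maps and Sweedler sums *)

Section LinearMaps.
Variable k : fieldType.
Implicit Types V W U X : lmodType k.

Lemma linD V W (f : V -> W) : linear f -> forall x y, f (x + y) = f x + f y.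
Proof. by move=> fl x y; have := fl 1 x y; rewrite !scale1r. Qed.

Lemma lin0 V W (f : V -> W) : linear f -> f 0 = 0.
Proof. by move=> fl; apply: (addrI (f 0)); rewrite -(linD fl) !addr0. Qed.

Lemma linZ V W (f : V -> W) : linear f -> forall a x, f (a *: x) = a *: f x.
Proof. by move=> fl a x; have := fl a x 0; rewrite (lin0 fl) !addr0. Qed.

Lemma linN V W (f : V -> W) : linear f -> forall x, f (- x) = - f x.
Proof. by move=> fl x; rewrite -scaleN1r (linZ fl) scaleN1r. Qed.

Lemma linB V W (f : V -> W) : linear f -> forall x y, f (x - y) = f x - f y.
Proof. by move=> fl x y; rewrite (linD fl) (linN fl). Qed.

Lemma lin_sum V W (f : V -> W) : linear f ->
  forall I (r : seq I) F, f (\sum_(i <- r) F i) = \sum_(i <- r) f (F i).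
Proof. by move=> fl I r F; rewrite (big_morph f (linD fl) (lin0 fl)). Qed.

Lemma lin_id V : linear (fun x : V => x).
Proof. by []. Qed.

Lemma lin_comp V W U (g : W -> U) (f : V -> W) :
  linear g -> linear f -> linear (fun x => g (f x)).
Proof. by move=> gl fl a u v /=; rewrite fl gl. Qed.

Lemma lin_add V W (f g : V -> W) :
  linear f -> linear g -> linear (fun x => f x + g x).
Proof. by move=> fl gl a u v /=; rewrite fl gl scalerDr addrACA. Qed.

Lemma lin_scale V W (f : V -> W) a : linear f -> linear (fun x => a *: f x).
Proof. by move=> fl b u v /=; rewrite fl scalerDr !scalerA mulrC. Qed.

Lemma lin_scalel V W (f : V -> k) (w : W) :
  linear (f : V -> k^o) -> linear (fun x => f x *: w).
Proof. by move=> fl b u v /=; rewrite fl scalerDl scalerA. Qed.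

Lemma lin_bigsum V W I (r : seq I) (F : V -> I -> W) :
  (forall i, linear (F^~ i)) -> linear (fun x => \sum_(i <- r) F x i).
Proof.
move=> Fl a u v; rewrite scaler_sumr -big_split /=.
by apply: eq_bigr => i _; rewrite Fl.
Qed.

Lemma lin_biml V V' W U (f : V -> W -> U) (g : V' -> V) w :
  bilin f -> linear g -> linear (fun x => f (g x) w).
Proof. by move=> fb; apply: (lin_comp (g := f^~ w)); apply: fb.1. Qed.

Lemma lin_bimr V W W' U (f : V -> W -> U) (g : W' -> W) v :
  bilin f -> linear g -> linear (fun x => f v (g x)).
Proof. by move=> fb; apply: (lin_comp (g := f v)); apply: fb.2. Qed.

Lemma lin_swl V W U X (f : V -> W -> U) (t : X -> V ⊗ W) :
  bilin f -> linear t -> linear (fun x => sw (t x) f).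
Proof. by move=> fb; apply: (lin_comp (g := fun t => sw t f)); apply: sw_linear. Qed.

(** [sw t] sums over one fixed representative of [t], so [F x] need not be bilinear; [eq_sw],
    [lin_sw] and [sw_exchange] rest on the same remark. *)
Lemma lin_swr V W U X (t : V ⊗ W) (F : X -> V -> W -> U) :
  (forall v w, linear (fun x => F x v w)) -> linear (fun x => sw t (F x)).
Proof. by move=> Fl; apply: lin_bigsum => p; apply: Fl. Qed.

Lemma bilinP V W U (f : V -> W -> U) :
  (forall w, linear (fun v => f v w)) -> (forall v, linear (fun w => f v w)) ->
  bilin f.
Proof. by move=> h1 h2; split=> x; [apply: h1|apply: h2]. Qed.

End LinearMaps.

(* The (bi)linearity of unknown operations must be among the hypotheses. *)
Ltac lin_hyp := first [assumption | exact: pure_bilin | solve [auto 2 with nocore]].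

(** The search follows the head of the function body. A Sweedler sum may be linear through its
    summand or through its tensor, and a binary operation through either argument; the options are
    tried in turn. *)
Ltac lin_unary :=
  lazymatch goal with
  | |- GRing.linear_for _ (fun x => ?op (@?f x)) =>
      refine (@lin_comp _ _ _ _ op f _ _); [lin_hyp | lin]
  end
with lin :=
  cbv beta;
  lazymatch goal with
  | |- bilinear_for _ _ _ =>
      first [lin_hyp | apply: bilinP => ?; lin]
  | |- GRing.linear_for _ (fun x => x) => exact: lin_id
  | |- GRing.linear_for _ (fun x => @GRing.add _ (@?f x) (@?g x)) =>
      apply: (lin_add (f := f) (g := g)); lin
  | |- GRing.linear_for _ (fun x => @GRing.scale _ _ _ _) =>
      first [ refine (@lin_scale _ _ _ _ _ _); lin
            | refine (@lin_scalel _ _ _ _ _ _); lin ]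
  | |- GRing.linear_for _ (fun x => @sw _ _ _ _ _ _) =>
      first [ refine (@lin_swr _ _ _ _ _ _ _ _) => ? ?; lin
            | refine (@lin_swl _ _ _ _ _ _ _ _ _); lin ]
  | |- GRing.linear_for _ (fun x => ?op (@?f x) (@?g x)) =>
      first [ assumption
            | refine (@lin_biml _ _ _ _ _ op f _ _ _); [lin_hyp | lin]
            | refine (@lin_bimr _ _ _ _ _ op g _ _ _); [lin_hyp | lin]
            | lin_unary ]
  | |- GRing.linear_for _ (fun x => _ _) => first [assumption | lin_unary]
  | |- GRing.linear_for _ ?f => lin_hyp
  end.

Section Sweedler.
Variable k : fieldType.
Implicit Types V W U X Y : lmodType k.

Lemma eq_sw V W U (t : V ⊗ W) (f g : V -> W -> U) :
  (forall v w, f v w = g v w) -> sw t f = sw t g.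
Proof. by move=> fg; apply: eq_bigr => p _; apply: fg. Qed.

Lemma lin_sw V W U X (g : U -> X) (t : V ⊗ W) (f : V -> W -> U) :
  linear g -> g (sw t f) = \sw_(v, w <- t) g (f v w).
Proof. by move=> gl; rewrite /sw /fsum (lin_sum gl). Qed.

Lemma sw_sw V W X Y U (t : V ⊗ W) (f : V -> W -> X ⊗ Y) (g : X -> Y -> U) :
  bilin g -> sw (sw t f) g = \sw_(v, w <- t) sw (f v w) g.
Proof. by move=> gb; apply: (lin_sw (g := fun s => sw s g)); apply: sw_linear. Qed.

Lemma sw_exchange V W X Y U (t : V ⊗ W) (s : X ⊗ Y) (F : V -> W -> X -> Y -> U) :
  (\sw_(a, b <- t) \sw_(c, d <- s) F a b c d)
    = \sw_(c, d <- s) \sw_(a, b <- t) F a b c d.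
Proof. exact: exchange_big. Qed.

Lemma sw_add V W U (t : V ⊗ W) (f g : V -> W -> U) :
  (\sw_(v, w <- t) (f v w + g v w)) = sw t f + sw t g.
Proof. exact: big_split. Qed.

Lemma lin_tens V W U (F G : V ⊗ W -> U) : linear F -> linear G ->
  (forall v w, F (v ⊗ w) = G (v ⊗ w)) -> forall t, F t = G t.
Proof.
by move=> Fl Gl FG t; rewrite (tens_sum t) !lin_sw //; apply: eq_sw => v w.
Qed.

Lemma tmap_lin V W V' W' (f : V -> V') (g : W -> W') :
  linear f -> linear g -> linear (tmap f g).
Proof. by move=> fl gl; rewrite /tmap; lin. Qed.

Lemma tmapE V W V' W' (f : V -> V') (g : W -> W') v w :
  linear f -> linear g -> tmap f g (v ⊗ w) = f v ⊗ g w.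
Proof. by move=> fl gl; rewrite /tmap swE //; lin. Qed.

Lemma sw_tmap V W V' W' U (f : V -> V') (g : W -> W') (h : V' -> W' -> U) t :
  linear f -> linear g -> bilin h ->
  sw (tmap f g t) h = \sw_(v, w <- t) h (f v) (g w).
Proof.
by move=> fl gl hb; rewrite /tmap sw_sw //; apply: eq_sw => v w; rewrite swE.
Qed.

Lemma bilZr V W U (f : V -> W -> U) : bilin f ->
  forall a v w, f v (a *: w) = a *: f v w.
Proof. by move=> fb a v w; rewrite (linZ (fb.2 v)). Qed.

Lemma sw_pure V W U (G : V ⊗ W -> U) (t : V ⊗ W) :
  linear G -> (\sw_(v, w <- t) G (v ⊗ w)) = G t.
Proof. by move=> Gl; rewrite [in RHS](tens_sum t) lin_sw. Qed.

(** Turns identities stated with [tassoc], such as coassociativity, into equalities of iterated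
    Sweedler sums with trilinear summands. *)
Lemma tassoc_sw V W X U (F : V -> W -> X -> U) (t : V ⊗ W ⊗ X) :
  (forall w x, linear (fun v => F v w x)) ->
  (forall v x, linear (fun w => F v w x)) ->
  (forall v w, linear (fun x => F v w x)) ->
  (\sw_(v, p <- tassoc t) \sw_(w, x <- p) F v w x)
    = \sw_(p, x <- t) \sw_(v, w <- p) F v w x.
Proof.
move=> F1 F2 F3; have Fb v : bilin (fun w x => F v w x) by exact: bilinP.
have Gb : bilin (fun v p => \sw_(w, x <- p) F v w x).
  by apply: bilinP => [p|v]; [apply: lin_swr => w x|apply: sw_linear].
rewrite /tassoc sw_sw //; apply: eq_sw => p x.
by rewrite sw_sw //; apply: eq_sw => v w; rewrite !swE.
Qed.

End Sweedler.

(** * Linear functionals separate tensors *)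

Section Separation.
Variable k : fieldType.
Implicit Types V W : lmodType k.

Definition vspan V (s : seq V) (v : V) : Prop :=
  exists c : nat -> k, v = \sum_(i < size s) c i *: s`_i.

Let subspace V (P : V -> Prop) :=
  P 0 /\ forall a u v, P u -> P v -> P (a *: u + v).

Lemma vspan_subspace V (s : seq V) : subspace (vspan s).
Proof.
split=> [|a u v [c ->] [d ->]].
  by exists (fun=> 0); rewrite big1 // => i _; rewrite scale0r.
exists (fun i => a * c i + d i); rewrite scaler_sumr -big_split /=.
by apply: eq_bigr => i _; rewrite scalerDl scalerA.
Qed.

(* Zorn: a subspace maximal among those containing P and avoiding v is a
   hyperplane, complementary to the line spanned by v. *)
Lemma separating_functional V (P : V -> Prop) (v : V) :
  subspace P -> ~ P v ->
  exists phi : V -> k^o, [/\ linear phi, phi v = 1 & forall u, P u -> phi u = 0].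
Proof.
move=> [P0 PD] Pv.
pose Q (M : set V) := (M = set0) \/ [/\ subspace M, forall u, P u -> M u & ~ M v].
have QP : Q P by right; split.
have [M [QM Mmax]] : exists A, Q A /\ forall B, (A `<` B)%classic -> ~ Q B.
  apply: Zorn_bigcup => F FQ Ftot.
  have [[X [FX X0]]|nF] := pselect (exists X, F X /\ X !=set0%classic); last first.
    left; apply/seteqP; split=> [x [X FX Xx]|x []].
    by apply: nF; exists X; split=> //; exists x.
  have good Y : F Y -> (exists y, Y y) -> [/\ subspace Y, forall u, P u -> Y u & ~ Y v].
    by move=> FY [y Yy]; have [Y0|//] := FQ _ FY; rewrite Y0 in Yy.
  have [Xs XP Xv] := good X FX X0.
  right; split; [split|..].
  - by exists X => //; apply: Xs.1.
  - move=> a u w [Y FY Yu] [Z FZ Zw].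
    have [YZ|ZY] := Ftot _ _ FY FZ.
    + have [Zs _ _] := good Z FZ (ex_intro _ _ Zw).
      by exists Z => //; apply: Zs.2 => //; apply: YZ.
    + have [Ys _ _] := good Y FY (ex_intro _ _ Yu).
      by exists Y => //; apply: Ys.2 => //; apply: ZY.
  - by move=> u Pu; exists X => //; apply: XP.
  - by move=> [Y FY Yv]; have [_ _] := good Y FY (ex_intro _ _ Yv); apply.
have {QM} [[M0 MD] PM Mv] : [/\ subspace M, forall u, P u -> M u & ~ M v].
  (* A maximal set is not empty: [P] itself satisfies [Q] and would be strictly larger. *)
  case: QM => // M0; exfalso; apply: (Mmax P) => //; split.
    by rewrite M0 => x.
  by move=> PM; have := PM 0 P0; rewrite M0.
have MZ a u : M u -> M (a *: u) by move=> Mu; rewrite -[_ *: _]addr0; apply: MD.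
have ex (x : V) : exists c, M (x - c *: v).
  have [Mx|nMx] := pselect (M x); first by exists 0; rewrite scale0r subr0.
  (* By maximality the larger subspace [M + k x] contains [v], so [v = a x + m]. Here [a] is nonzero
     because [v] is not in [M], and [c = a^-1] works. *)
  pose B (y : V) := exists m a, M m /\ y = a *: x + m.
  have [m [a [Mm va]]] : B v.
    apply: contrapT => nBv; apply: (Mmax B).
      split=> [y My|BM]; first by exists y, 0; rewrite scale0r add0r.
      by apply: nMx; apply: BM; exists 0, 1; rewrite scale1r addr0.
    right; split=> //; last first.
      by move=> u Pu; exists u, 0; rewrite scale0r add0r; split=> //; apply: PM.
    split; first by exists 0, 0; rewrite scale0r addr0.
    move=> b _ _ [m [a [Mm ->]]] [m' [a' [Mm' ->]]].
    exists (b *: m + m'), (b * a + a'); split; first exact: MD.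
    by rewrite scalerDr scalerDl scalerA addrACA.
  have a0 : a != 0.
    by apply/eqP => a0; apply: Mv; rewrite va a0 scale0r add0r.
  exists a^-1; rewrite va scalerDr scalerA mulVf // scale1r opprD addNKr.
  by rewrite -scalerN -scaleN1r; apply/MZ/MZ.
have uniq x c d : M (x - c *: v) -> M (x - d *: v) -> c = d.
  move=> Mc Md; apply/eqP; rewrite -subr_eq0; apply/negPn/negP => cd.
  apply: Mv; rewrite -[v]scale1r -(mulVf cd) -scalerA; apply: MZ.
  have -> : (c - d) *: v = (- 1) *: (x - c *: v) + (x - d *: v).
    by rewrite scaleN1r opprB scalerBl addrA addrNK.
  exact: MD.
(* The value at [x] is the unique [c] with [x - c v] in [M]; linearity follows from uniqueness. *)
exists (fun x => projT1 (cid (ex x))); split.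
- move=> a x y; case: cid => c /= Mc; case: cid => d /= Md; case: cid => e /= Me.
  apply: (uniq _ _ _ Mc).
  have -> : a *: x + y - (a *: (d : k^o) + e) *: v
            = a *: (x - d *: v) + (y - e *: v).
    by rewrite scalerDl scalerBr scalerA opprD addrACA.
  exact: MD.
- case: cid => c /= Mc; apply: (uniq _ _ _ Mc).
  by rewrite scale1r subrr.
- move=> u /PM Mu; case: cid => c /= Mc; apply: (uniq _ _ _ Mc).
  by rewrite scale0r subr0.
Qed.

(** Induction on the length of a sum representing [t]. If its first vector [v] depends on the
    others, its term is absorbed by them; otherwise a functional that is 1 on [v] and 0 on the
    others forces the cofactor [w] of [v] to vanish. *)
Lemma tens_sep V W (t : V ⊗ W) :
  (forall phi : V -> k^o, linear phi -> (\sw_(v, w <- t) ((phi v : k) *: w)) = 0) ->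
  t = 0.
Proof.
have pl (v : V) : linear (fun w : W => v ⊗ w) by lin.
have pr (w : W) : linear (fun v : V => v ⊗ w) by lin.
suff key n (s : seq (V * W)) : size s = n ->
    (forall phi : V -> k^o, linear phi -> \sum_(p <- s) (phi p.1 : k) *: p.2 = 0) ->
    \sum_(p <- s) p.1 ⊗ p.2 = 0.
  move=> h; rewrite (tens_sum t); apply: (key _ _ erefl) => phi phil.
  exact: h.
elim: n s => [|n IH] [|[v w] s] //= => [_ _|[sz] h]; first by rewrite big_nil.
have {}h phi : linear (phi : V -> k^o) ->
    (phi v : k) *: w + \sum_(p <- s) (phi p.1 : k) *: p.2 = 0.
  by move=> /h; rewrite big_cons.
rewrite big_cons /=.
have [[c vE]|nv] := pselect (vspan (map fst s) v).
  (* With [v = sum c_i v_i], the sum of [v ⊗ w] and the [v_i ⊗ w_i] becomes the shorter sum of the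
     [v_i ⊗ (w_i + c_i w)]. *)
  pose s' := mkseq (fun i => ((nth 0 s i).1, (nth 0 s i).2 + c i *: w)) (size s).
  have vE' : v = \sum_(i < size s) c i *: (nth 0 s i).1.
    rewrite vE size_map; apply: eq_bigr => i _.
    by rewrite (nth_map 0).
  have big' (U : lmodType k) (f : V -> W -> U) : bilin f ->
      \sum_(p <- s') f p.1 p.2 = f v w + \sum_(p <- s) f p.1 p.2.
    move=> fb; rewrite big_map -[size s]subn0 -/(index_iota 0 _) big_mkord /=.
    rewrite [X in _ + X](big_nth 0) big_mkord vE'.
    rewrite (lin_sum (fb.1 w)) -big_split /=; apply: eq_bigr => i _.
    by rewrite (linD (fb.2 _)) (linZ (fb.2 _)) (linZ (fb.1 _)) addrC.
  rewrite -(big' _ pure); last by lin.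
  apply: IH => [|phi phil]; first by rewrite size_mkseq.
  by rewrite (big' _ (fun v w => (phi v : k) *: w)) ?h //; lin.
have [phi [phil phiv phis]] := separating_functional (vspan_subspace _) nv.
have mem p : p \in s -> vspan (map fst s) p.1.
  (* The coefficients form a Kronecker delta at the first occurrence, since the first components may
     repeat. *)
  move=> ps; exists (fun i => (i == index p.1 (map fst s))%:R).
  have lt : (index p.1 (map fst s) < size (map fst s))%N.
    by rewrite index_mem map_f.
  rewrite (bigD1 (Ordinal lt)) //= eqxx scale1r nth_index ?map_f // big1 ?addr0 //.
  by move=> i /negbTE; rewrite -val_eqE /= => ->; rewrite scale0r.
have w0 : w = 0.
  have := h phi phil; rewrite phiv scale1r big_seq big1 ?addr0 //.
  by move=> p /mem /phis ->; rewrite scale0r.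
rewrite w0 (lin0 (pl v)) add0r; apply: IH => // psi psil.
by have := h psi psil; rewrite w0 scaler0 add0r.
Qed.

End Separation.
(** * The braiding of a Hom-Yetter-Drinfeld algebra *)

Section Module.
Variables (k : fieldType) (H : homHopf k) (M : hyd H).
Hypotheses (hopfH : is_homHopf H) (invH : involutive (haut H)).
Hypotheses (hydM : is_hyd M) (invM : involutive (haut M)).

Lemma hautV_inv (X : homObj k) (x : X) :
  is_homObj X -> involutive (haut X) -> hautV X x = haut X x.
Proof. by case=> _ hK _ inv; rewrite -[x in LHS]inv hK. Qed.

Lemma hautV_lin (X : homObj k) :
  is_homObj X -> involutive (haut X) -> linear (hautV X).
Proof. by move=> oX inv a u v; have [hl _ _] := oX; rewrite !hautV_inv // hl. Qed.

Lemma hautVH h : hautV H h = haut H h.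
Proof. by apply: hautV_inv => //; case: hopfH. Qed.

Lemma hautVM m : hautV M m = haut M m.
Proof. by apply: hautV_inv => //; case: hydM. Qed.

Lemma alpha_lin : linear (haut H).
Proof. by case: hopfH => [[]]. Qed.

Lemma hmul_bilin : bilin (@hmul k H).
Proof. by case: hopfH => [_ []]. Qed.

Lemma hcomul_lin : linear (@hcomul k H).
Proof. by case: hopfH => [_ _ [[]]]. Qed.

Lemma hcounit_lin : linear (@hcounit k H : H -> k^o).
Proof. by case: hopfH => [_ _ [[]]]. Qed.

Lemma hcomul_alpha h : hcomul (haut H h) = tmap (haut H) (haut H) (hcomul h).
Proof. by case: hopfH => [_ _ []]. Qed.

Lemma haut_lin : linear (haut M).
Proof. by case: hydM => [[]]. Qed.

Lemma act_bilin : bilin (@act k H M).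
Proof. by case: hydM => [_ []]. Qed.

Lemma coact_lin : linear (@coact k H M).
Proof. by case: hydM => [_ _ []]. Qed.

Lemma actA h g (m : M) : act (haut H h) (act g m) = act (hmul h g) (haut M m).
Proof. by case: hydM => [_ []]. Qed.

Lemma act1 (m : M) : act (hone H) m = haut M m.
Proof. by case: hydM => [_ []]. Qed.

Lemma haut_act h (m : M) : haut M (act h m) = act (haut H h) (haut M m).
Proof. by case: hydM => [_ []]. Qed.

Lemma coact_haut (m : M) : coact (haut M m) = tmap (haut H) (haut M) (coact m).
Proof. by case: hydM => [_ _ []]. Qed.

Lemma coact_counit (m : M) :
  (\sw_(h, n <- coact m) (hcounit h *: n)) = haut M m.
Proof. by rewrite -hautVM; case: hydM => [_ _ []]. Qed.

(** The comodule axiom evaluated on a trilinear [F]; involutivity replaces the inverse automorphisms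
    by the automorphisms themselves. *)
Lemma coact_coassoc (U : lmodType k) (F : H -> H -> M -> U) (m : M) :
  (forall g n, linear (fun h => F h g n)) ->
  (forall h n, linear (fun g => F h g n)) ->
  (forall h g, linear (fun n => F h g n)) ->
  (\sw_(h, n <- coact m) \sw_(h1, h2 <- hcomul h) F h1 h2 (haut M n))
    = \sw_(h, n <- coact m) \sw_(g, p <- coact n) F (haut H h) g p.
Proof.
move=> F1 F2 F3.
have Gb : bilin (fun h p => \sw_(g, n <- p) F h g n).
  apply: bilinP => [p|h]; first by apply: lin_swr => g n.
  by apply: sw_linear; apply: bilinP.
have G'b : bilin (fun p n => \sw_(h, g <- p) F h g n).
  apply: bilinP => [n|p]; last by apply: lin_swr => h g.
  by apply: sw_linear; apply: bilinP.
have Vl : linear (hautV H) by apply: hautV_lin => //; case: hopfH.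
have VMl : linear (hautV M) by apply: hautV_lin => //; case: hydM.
have : tassoc (tmap (@hcomul k H) (hautV M) (coact m))
       = tmap (hautV H) (@coact k H M) (coact m) by case: hydM => [_ _ []].
move=> /(congr1 (fun t => \sw_(h, p <- t) \sw_(g, n <- p) F h g n)).
have cl := hcomul_lin; have col := coact_lin.
rewrite tassoc_sw // !sw_tmap // => e.
transitivity (\sw_(v, w <- coact m) \sw_(h, g <- hcomul v) F h g (hautV M w)).
  by apply: eq_sw => v w; rewrite hautVM.
by rewrite e; apply: eq_sw => v w; rewrite hautVH.
Qed.

Lemma braidE (N : hyd H) (m : M) (n : N) : is_hyd N -> involutive (haut N) ->
  braid (m ⊗ n) = \sw_(h, p <- coact m) (act h (haut N n) ⊗ haut M p).
Proof.
move=> hydN invN.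
have hl := haut_lin; have col := coact_lin.
have [[nl nK _] [nb _ _ _] _ _] := hydN.
have hVl : linear (hautV N) by apply: hautV_lin => //; case: hydN.
rewrite /braid swE; last by lin.
by apply: eq_sw => h p; rewrite hautV_inv //; case: hydN.
Qed.

Lemma braid_lin (N : hyd H) : is_hyd N -> involutive (haut N) ->
  linear (@braid k H M N).
Proof.
move=> hydN invN.
have hl := haut_lin; have col := coact_lin.
have [[nl nK _] [nb _ _ _] _ _] := hydN.
have hVl : linear (hautV N) by apply: hautV_lin => //; case: hydN.
by rewrite /braid; lin.
Qed.

End Module.

Section Algebra.
Variables (k : fieldType) (H : homHopf k) (A : hyd H).
Variables (mul : A -> A -> A) (one : A).
Hypotheses (hopfH : is_homHopf H) (invH : involutive (haut H)).
Hypotheses (algA : is_hydAlg mul one) (invA : involutive (haut A)).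

Let hydA : is_hyd A. Proof. by case: algA. Qed.

Let al := alpha_lin hopfH.
Let hmb := hmul_bilin hopfH.
Let hcl := hcomul_lin hopfH.
Let bl := haut_lin hydA.
Let ab := act_bilin hydA.
Let cl := coact_lin hydA.
Let Cl := braid_lin hydA hydA invA.
Let mb : bilin mul. Proof. by case: algA => [_ []]. Qed.

Local Notation braidA := (@braid k H A A).

Lemma beta_mul a b : haut A (mul a b) = mul (haut A a) (haut A b).
Proof. by case: algA => [_ []]. Qed.

Lemma mul1 a : mul a one = haut A a.
Proof. by case: algA => [_ [_ _ _ h _]] _ _; case: (h a). Qed.

Lemma mul1l a : mul one a = haut A a.
Proof. by case: algA => [_ [_ _ _ h _]] _ _; case: (h a). Qed.

Lemma beta_one : haut A one = one.
Proof. by case: algA => [_ []]. Qed.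

Lemma act_mul h a b :
  act h (mul a b) = \sw_(h1, h2 <- hcomul h) mul (act h1 a) (act h2 b).
Proof.
case: algA => _ _ [_ _ /(_ h (a ⊗ b)) /= + _] _.
rewrite swE // => <-; rewrite sw_sw //; apply: eq_sw => h1 h2.
have l1 g : linear (act (M := A) g) by move=> *; apply: ab.2.
by rewrite tmapE // swE.
Qed.

Lemma act_one h : act h one = hcounit h *: one.
Proof.
case: algA => _ _ _ [_ _ /(_ h 1) /= + _].
by rewrite scale1r mulr1 => <-.
Qed.

Lemma coact_mul a b : coact (mul a b)
  = \sw_(h, m <- coact a) \sw_(g, n <- coact b) (hmul h g ⊗ mul m n).
Proof.
case: algA => _ _ [_ _ _ /(_ (a ⊗ b)) /= +] _.
rewrite swE // => ->; rewrite swE; last by lin.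
have sl : linear (fun t => sw t mul) by exact: sw_linear.
have tl : linear (tmap (V := H) id (fun t => sw t mul)) by apply: tmap_lin.
rewrite lin_sw //; apply: eq_sw => h m; rewrite lin_sw //; apply: eq_sw => g n.
by rewrite tmapE // swE.
Qed.

Lemma coact_one : coact one = hone H ⊗ one.
Proof.
case: algA => _ _ _ [ul _ _ /(_ 1) /=].
by rewrite scale1r tmapE // scale1r.
Qed.

Lemma braidAE a b :
  braidA (a ⊗ b) = \sw_(h, n <- coact a) (act h (haut A b) ⊗ haut A n).
Proof. exact: braidE. Qed.

Lemma braid1l a : braidA (one ⊗ a) = a ⊗ one.
Proof. by rewrite braidAE coact_one swE ?act1 ?invA ?beta_one //; lin. Qed.

Lemma braid1r a : braidA (a ⊗ one) = one ⊗ a.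
Proof.
rewrite braidAE beta_one.
transitivity (one ⊗ haut A (\sw_(h, n <- coact a) (hcounit h *: n))).
  rewrite (lin_sw (g := haut A)) // (lin_sw (g := fun x => one ⊗ x)); last by lin.
  apply: eq_sw => h n; rewrite act_one (linZ bl).
  by rewrite (linZ ((pure_bilin _ _).1 _)) (linZ ((pure_bilin _ _).2 _)).
by rewrite coact_counit // invA.
Qed.

(* [mixl m a b] is the product (a ⊗ b)(β(m) ⊗ 1) in the braided algebra A ⊗ A,
   and [mixr m a b] is (a ⊗ b)(1 ⊗ β(m)). *)
Definition mixl m a b : A ⊗ A := \sw_(h, n <- coact b) (mul a (act h m) ⊗ n).
Definition mixr m a b : A ⊗ A := haut A a ⊗ mul b (haut A m).

Lemma mixl_bilin m : bilin (mixl m).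
Proof. by rewrite /mixl; lin. Qed.

Lemma mixr_bilin m : bilin (mixr m).
Proof. by rewrite /mixr; lin. Qed.

(** Hexagon for a product in the second factor: [act_mul] splits the acting element by the
    comultiplication, and coassociativity turns the two halves into successive coactions. This is
    the relation [C Y = X C]. *)
Lemma braid_mixr m a b : braidA (mixr m a b) = sw (braidA (a ⊗ b)) (mixl m).
Proof.
rewrite /mixr braidAE coact_haut // sw_tmap //; last by lin.
rewrite beta_mul invA.
have := mixl_bilin m => mlb.
rewrite braidAE sw_sw //.
transitivity (\sw_(h, n <- coact a) \sw_(h1, h2 <- hcomul h)
   (mul (act (haut H h1) (haut A b)) (act (haut H h2) m) ⊗ haut A (haut A n))).
  apply: eq_sw => h n; rewrite act_mul hcomul_alpha // invA sw_tmap //; last by lin.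
  rewrite (lin_sw (g := fun x => x ⊗ n)); last by lin.
  by apply: eq_sw.
rewrite (coact_coassoc hopfH invH hydA invA
  (F := fun h1 h2 n => mul (act (haut H h1) (haut A b)) (act (haut H h2) m) ⊗ haut A n)).
all: try by move=> *; lin.
apply: eq_sw => h n; rewrite swE // /mixl coact_haut // sw_tmap //; last by lin.
by rewrite invH.
Qed.

(** Hexagon for a product in the first factor: [c] crosses [m] and then [a], because the coaction of
    a product is a product in [H] and [actA] splits its action. *)
Lemma braid_mull a m c : braidA (mul a m ⊗ c)
  = \sw_(h, n <- coact m) sw (braidA (a ⊗ act h c)) (mixr n).
Proof.
rewrite braidAE coact_mul sw_sw; last by lin.
under [RHS]eq_sw => h n.
  have := mixr_bilin n => mrb.
  rewrite braidAE sw_sw //.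
  over.
rewrite sw_exchange; apply: eq_sw => h n.
rewrite sw_sw; last by lin.
apply: eq_sw => g p.
have := mixr_bilin p => mrb.
rewrite !swE; [|lin|lin].
by rewrite /mixr beta_mul (haut_act hydA h) invA actA.
Qed.

(** The two hexagons and the first hypothesis reduce the left side to a sum of [mixl n a (act h c)].
    That sum is the image under [mul a ⊗ β] of [C(C(m ⊗ β(c)))], which the second hypothesis
    evaluates. *)
Lemma braid2_mull a m c :
  (forall h, braidA (braidA (a ⊗ act h c)) = a ⊗ act h c) ->
  braidA (braidA (m ⊗ haut A c)) = m ⊗ haut A c ->
  braidA (braidA (mul a m ⊗ c)) = mul a m ⊗ c.
Proof.
move=> hA hM; rewrite braid_mull.
have ml p := mixl_bilin p; have mr p := mixr_bilin p.
rewrite lin_sw //.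
transitivity (\sw_(h, n <- coact m) mixl n a (act h c)).
  apply: eq_sw => h n; rewrite lin_sw //.
  under eq_sw => x y do rewrite braid_mixr.
  rewrite (sw_pure (G := fun t => sw (braidA t) (mixl n))); last by lin.
  by rewrite hA (swE (ml n)).
have := hM; rewrite braidAE invA lin_sw //.
move=> /(congr1 (tmap (mul a) (haut A))).
have mal : linear (mul a) by move=> *; apply: mb.2.
have tl : linear (tmap (mul a) (haut A)) by apply: tmap_lin.
rewrite tmapE // invA => <-; rewrite lin_sw //; apply: eq_sw => h n.
rewrite braidAE invA lin_sw //; apply: eq_sw => g p.
by rewrite tmapE // invA.
Qed.

(** The converse relation [C X = Y C]. Unlike [C Y = X C], it brings in the double crossing of [b]
    and [β(m)], which the hypothesis removes. *)
Lemma braid_mixl m a b : braidA (braidA (b ⊗ haut A m)) = b ⊗ haut A m ->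
  braidA (mixl m a b) = sw (braidA (a ⊗ b)) (mixr m).
Proof.
move=> hM; have ml p := mixl_bilin p; have mr p := mixr_bilin p.
rewrite /mixl lin_sw //.
have Gb : bilin (fun x y => sw (braidA (a ⊗ x)) (mixr (haut A y))).
  apply: bilinP => [y|x]; first by lin.
  by apply: lin_swr => u v; rewrite /mixr; lin.
(* On [b ⊗ β(m)] this map gives the right side; on [C(C(b ⊗ β(m)))] it gives the expansion of the
   left side by [braid_mull]. *)
have := congr1 (fun t => \sw_(x, y <- t) sw (braidA (a ⊗ x)) (mixr (haut A y))) hM.
rewrite /= swE // invA => <-.
rewrite braidAE invA lin_sw // sw_sw //; apply: eq_sw => h n.
rewrite braid_mull braidAE invA sw_sw //; apply: eq_sw => g p.
by rewrite swE // invA.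
Qed.

Lemma braid2_mixr m a b :
  (forall b', braidA (braidA (b' ⊗ haut A m)) = b' ⊗ haut A m) ->
  braidA (braidA (a ⊗ b)) = a ⊗ b ->
  braidA (braidA (mixr m a b)) = mixr m a b.
Proof.
move=> hM hA; have ml p := mixl_bilin p; have mr p := mixr_bilin p.
rewrite braid_mixr lin_sw //.
under eq_sw => x y do rewrite braid_mixl //.
by rewrite (sw_pure (G := fun t => sw (braidA t) (mixr m))) ?hA ?(swE (mr m)) //; lin.
Qed.

(** * From generators to the whole algebra *)

Section Generators.
Variables (L : hyd H) (iota : L -> A).
Hypotheses (hydL : is_hyd L) (invL : involutive (haut L)).
Hypothesis iota_lin : linear iota.
Hypothesis iota_act : forall h l, act h (iota l) = iota (act h l).
Hypothesis iota_haut : forall l, haut A (iota l) = iota (haut L l).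
Hypothesis iota_coact : forall l, coact (iota l) = tmap id iota (coact l).
Hypothesis gen : forall Q : A -> Prop,
  (forall c u v, Q u -> Q v -> Q (c *: u + v)) -> Q one ->
  (forall a l, Q a -> Q (mul a (iota l))) -> forall a, Q a.

(** Two inductions along [gen]: first on the left factor with a generator on the right, then on the
    right factor with an arbitrary left factor. *)
Lemma braid_involutive :
  (forall x y, braidA (braidA (iota x ⊗ iota y)) = iota x ⊗ iota y) ->
  involutive braidA.
Proof.
move=> hL.
have BBl : linear (fun t => braidA (braidA t) : A ⊗ A) by lin.
have step1 b l : braidA (braidA (b ⊗ iota l)) = b ⊗ iota l.
  (* [l] stays quantified because [braid2_mull] calls for the induction hypothesis at every
     [act h l]. *)
  move: b l; apply: gen => [c u v hu hv l|l|a m IH l].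
  - by rewrite (pure_bilin _ _).1 BBl hu hv.
  - by rewrite braid1l braid1r.
  - apply: braid2_mull => [h|]; first by rewrite iota_act.
    by rewrite iota_haut.
have step2 b a : braidA (braidA (a ⊗ b)) = a ⊗ b.
  move: b a; apply: gen => [c u v hu hv a|a|b l IH a].
  - by rewrite (pure_bilin _ _).2 BBl hu hv.
  - by rewrite braid1r braid1l.
  (* [mixr] twists the left factor and its parameter by [β]; applying [β] beforehand cancels this,
     so the induction hypothesis is used at [β(a)]. *)
  - have -> : a ⊗ mul b (iota l) = mixr (iota (haut L l)) (haut A a) b.
      by rewrite /mixr iota_haut !invA invL.
    by apply: braid2_mixr => // b'; rewrite iota_haut.
by move=> t; apply: (lin_tens (F := fun t => braidA (braidA t))).
Qed.

Variables (comul : A -> A ⊗ A).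
Hypothesis comul_lin : linear comul.
Hypothesis comul_mul :
  forall a b, comul (mul a b) = braid_mul mul (comul a) (comul b).
Hypothesis comul_one : comul one = one ⊗ one.
Hypothesis comul_iota : forall l,
  comul (iota l) = haut A (iota l) ⊗ one + one ⊗ haut A (iota l).

(** The two summands of [Δ(iota l)] multiply [Δ(a)] on the right, giving the operators [X_l] and
    [Y_l]. *)
Lemma comul_mul_iota a l : comul (mul a (iota l))
  = sw (comul a) (mixl (iota l)) + sw (comul a) (mixr (iota l)).
Proof.
have Vl : linear (hautV A) by apply: hautV_lin => //; case: hydA.
rewrite comul_mul comul_iota /braid_mul -sw_add; apply: eq_sw => x y.
rewrite (linD (sw_linear _)); last by lin.
rewrite !swE; [|lin|lin]; congr (_ + _).
  by apply: eq_sw => h n; rewrite hautVM // invA mul1 invA.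
transitivity (haut A x ⊗ mul (haut A (haut A y)) (haut A (iota l))); last first.
  by rewrite invA.
(* In the braided product the coaction of [y] acts on [one] through the counit only; expanding
   [β(y)] by the counit axiom matches the two sums. *)
rewrite -[haut A y](coact_counit hydA invA) (lin_sw (g := haut A)) //.
rewrite (lin_sw (g := fun z => haut A x ⊗ mul z (haut A (iota l)))); last by lin.
apply: eq_sw => h n; rewrite hautVM // beta_one act_one.
rewrite (bilZr mb) mul1 (linZ bl) (bilZl mb) (bilZl (pure_bilin _ _)).
by rewrite (bilZr (pure_bilin _ _)).
Qed.

(** [X] and [Y] are applied to both summands of [Δ(iota x)]. [Y] on [β(iota x) ⊗ one] yields
    [iota x ⊗ iota y], and [X] on [one ⊗ β(iota x)] yields its braiding. *)
Lemma comul_iota2 x y (m := mul (iota x) (iota y)) :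
  comul m = haut A m ⊗ one + (iota x ⊗ iota y + braidA (iota x ⊗ iota y))
            + one ⊗ haut A m.
Proof.
have ml p := mixl_bilin p; have mr p := mixr_bilin p.
rewrite /m comul_mul_iota comul_iota.
rewrite !(linD (sw_linear (ml _))) !(linD (sw_linear (mr _))) !(swE (ml _)) !(swE (mr _)).
rewrite beta_mul addrACA -!addrA; congr (_ + _).
  by rewrite /mixl coact_one swE ?act1 //; lin.
congr (_ + (_ + _)).
- by rewrite /mixr invA mul1l invA.
- rewrite /mixl coact_haut // sw_tmap //; last by lin.
  rewrite braidAE; apply: eq_sw => h n.
  by rewrite mul1l haut_act // invH.
- by rewrite /mixr beta_one.
Qed.

Variable bracket : L -> L -> L.
Hypothesis iota_rel : forall x y, mul (iota x) (iota y)
  = (\sw_(h, p <- coact x) mul (iota (act h (haut L y))) (iota (haut L p)))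
    + iota (bracket x y).

(** Naturality of the braiding for [iota]. *)
Lemma braid_iota x y :
  braidA (iota x ⊗ iota y) = tmap iota iota (@braid k H L L (x ⊗ y)).
Proof.
have tl : linear (tmap iota iota) by apply: tmap_lin.
have lb := haut_lin hydL.
rewrite braidAE iota_coact sw_tmap //; last by lin.
rewrite braidE // lin_sw //; apply: eq_sw => h p.
by rewrite tmapE // !iota_haut iota_act.
Qed.

(** For [t = iota x ⊗ iota y], the mixed part of [Δ] is [t + C t] on the left of the defining
    relation and [C t + C(C t)] on the right; the bracket contributes none. *)
Lemma braid2_iota x y : braidA (braidA (iota x ⊗ iota y)) = iota x ⊗ iota y.
Proof.
have tl : linear (tmap iota iota) by apply: tmap_lin.
have lb := haut_lin hydL.
have lab := act_bilin hydL.
have lcl := coact_lin hydL.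
have Ml : linear (fun t => sw t mul) by apply: sw_linear.
pose D (m : A) (t : A ⊗ A) := haut A m ⊗ one + (t + braidA t) + one ⊗ haut A m.
(* Extending [comul_iota2] linearly makes it available at the braiding of [x ⊗ y], which is not a
   pure tensor in general. *)
have DE (s : L ⊗ L) : comul (sw (tmap iota iota s) mul)
      = D (sw (tmap iota iota s) mul) (tmap iota iota s).
  move: s; apply: lin_tens; [lin| rewrite /D|].
  - apply: lin_add; last by lin.
    by apply: lin_add; [lin|apply: lin_add; lin].
  - by move=> v w; rewrite tmapE // swE // comul_iota2.
have sE : tmap iota iota (x ⊗ y) = iota x ⊗ iota y by rewrite tmapE.
have := DE (x ⊗ y); have := DE (@braid k H L L (x ⊗ y)).
rewrite -braid_iota sE swE //.
set t := iota x ⊗ iota y; set m' := sw _ mul => DEm'.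
have -> : mul (iota x) (iota y) = m' + iota (bracket x y).
  rewrite iota_rel /m' braid_iota sw_tmap // braidE // sw_sw; last by lin.
  by congr (_ + _); apply: eq_sw => h p; rewrite swE //; lin.
rewrite (linD comul_lin) DEm' comul_iota /D (linD bl).
rewrite (linD ((pure_bilin _ _).1 _)) (linD ((pure_bilin _ _).2 _)).
set p := haut A m' ⊗ one; set q := one ⊗ haut A m'.
set r := _ ⊗ one; set s := one ⊗ _.
set c := braidA t => e; apply: (addrI c).
have h u : p + u + q + (r + s) = p + r + u + (q + s).
  rewrite -!addrA; congr (_ + _); rewrite [RHS]addrCA; congr (_ + _).
  by rewrite addrCA.
move: e; rewrite h => /addIr /addrI.
by rewrite [X in _ = X]addrC.
Qed.

Lemma comul_cocommutative : H_cocommutative comul.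
Proof.
have ml p := mixl_bilin p; have mr p := mixr_bilin p.
have BB := braid_involutive braid2_iota.
apply: gen => [c u v hu hv||a l IH].
- by rewrite comul_lin Cl hu hv.
- by rewrite comul_one braid1l.
have BY : braidA (sw (comul a) (mixr (iota l))) = sw (comul a) (mixl (iota l)).
  rewrite lin_sw //; under eq_sw => x y do rewrite braid_mixr.
  by rewrite (sw_pure (G := fun t => sw (braidA t) (mixl (iota l)))) ?IH //; lin.
by rewrite comul_mul_iota (linD Cl) BY -{1}BY BB addrC.
Qed.

End Generators.
End Algebra.
(** * The tensor algebra and the enveloping algebra *)

Section DirectSumMaps.
Variables (k : fieldType) (V : nat -> lmodType k).
Implicit Types U X : lmodType k.

Lemma din_lin n : linear (@din k V n).
Proof.
move=> a u v; apply: dsumP => m /=; rewrite /din_coef.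
by case: eqP => [e|_]; [case: m / e | rewrite scaler0 addr0].
Qed.

Lemma dsum_din (x : dsum V) : exists N, x = \sum_(n < N) din (x n).
Proof.
have [N xN] := dfin x; exists N; apply: dsumP => m.
have dm : linear (fun y : dsum V => y m) by [].
rewrite (lin_sum dm); have [Nm|mN] := leqP N m.
  rewrite xN // big1 // => i _; apply: din_neq.
  by rewrite neq_ltn (leq_trans (ltn_ord i) Nm).
rewrite (bigD1 (Ordinal mN)) //= -[din_coef _ _]/(din (x m) m) din_id.
by rewrite big1 ?addr0 // => i /negP im; apply: din_neq; apply/negP.
Qed.

Lemma lin_dsum U (F G : dsum V -> U) : linear F -> linear G ->
  (forall n v, F (din (n := n) v) = G (din v)) -> forall x, F x = G x.
Proof.
move=> Fl Gl FG x; have [N ->] := dsum_din x.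
by rewrite (lin_sum Fl) (lin_sum Gl); apply: eq_bigr.
Qed.

Lemma dlift_lin U (F : forall n, V n -> U) :
  (forall n, linear (F n)) -> linear (fun x : dsum V => dlift x F).
Proof.
move=> Fl a x y; have F0 n := lin0 (Fl n).
have [[N xN] [M yM]] := (dfin x, dfin y).
(* [N + M] bounds the supports of [x], [y] and [a *: x + y] at once. *)
have xNM n : (N + M <= n)%N -> x n = 0.
  by move=> le; apply: xN; apply: leq_trans le; apply: leq_addr.
have yNM n : (N + M <= n)%N -> y n = 0.
  by move=> le; apply: yM; apply: leq_trans le; apply: leq_addl.
rewrite (dliftE F0 xNM) (dliftE F0 yNM) (dliftE (N := N + M) F0).
  by rewrite scaler_sumr -big_split; apply: eq_bigr => i _; rewrite /= Fl.
by move=> n le; rewrite /= xNM // yNM // scaler0 addr0.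
Qed.

Lemma dlift_linr U X (x : dsum V) (F : X -> forall n, V n -> U) :
  (forall n v, linear (fun y : X => F y n v)) ->
  linear (fun y : X => dlift x (F y)).
Proof. by move=> Fl; apply: lin_bigsum => i; apply: Fl. Qed.

End DirectSumMaps.

Section TensorAlgebra.
Variables (k : fieldType) (H : homHopf k) (L : homLie H).
Hypotheses (hopfH : is_homHopf H).
Hypotheses (hydL : is_hyd L) (invL : involutive (haut L)).

Let hmb := hmul_bilin hopfH.
Let hcl := hcomul_lin hopfH.

Local Notation Tn := (tpow L).
Local Notation din := (@din k (tpow L) _).
Local Notation T := (T_obj L).
Local Notation one := (T_one L).

(** Here and below the induction separates degrees 0, 1 and [n.+2], because the first tensor power
    is [L] itself and not [k ⊗ L]. *)
Lemma tpow_haut_lin n : linear (haut (Tn n)).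
Proof.
elim: n => [//|[_|n IH]]; first exact: haut_lin.
by apply: tmap_lin => //; apply: haut_lin.
Qed.

Lemma tpow_haut_inv n : involutive (haut (Tn n)).
Proof.
elim: n => [//|[//|n IH]] t.
have hl := @tpow_haut_lin n.+1; have bl := haut_lin hydL.
have tl : linear (haut (Tn n.+2)) by apply: tpow_haut_lin.
move: t; apply: lin_tens => [||v l]; [lin|lin|].
rewrite -[v ⊗ l in RHS]/(v ⊗ l) /=.
by rewrite !tmapE // IH invL.
Qed.

Lemma tpow_act_lin n h : linear (@act k H (Tn n) h).
Proof.
elim: n h => [|[_|n IH]] h.
- by move=> a u v /=; rewrite /GRing.scale /= mulrDr mulrCA.
- by move=> *; apply: (act_bilin hydL).2.
- have al g : linear (@act k H L g) by move=> *; apply: (act_bilin hydL).2.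
  by apply: lin_swr => h1 h2; apply: tmap_lin.
Qed.

Lemma tpow_coact_lin n : linear (@coact k H (Tn n)).
Proof.
elim: n => [|[_|n IH]]; first 1 last.
- exact: coact_lin.
- by have cl := coact_lin hydL; rewrite /=; lin.
- by rewrite /=; lin.
Qed.

Lemma T_haut_lin : linear (haut T).
Proof.
apply: dlift_lin => n; apply: lin_comp; first exact: din_lin.
exact: tpow_haut_lin.
Qed.

Lemma T_haut_din n (v : Tn n) : haut T (din v) = din (haut (Tn n) v).
Proof.
rewrite /= dlift_din // => m.
by rewrite (lin0 (@tpow_haut_lin m)) (lin0 (@din_lin _ _ m)).
Qed.

Lemma T_haut_inv : involutive (haut T).
Proof.
have hl := T_haut_lin; apply: lin_dsum => // [|n v]; first by lin.
by rewrite !T_haut_din tpow_haut_inv.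
Qed.

Lemma T_act_lin h : linear (@act k H T h).
Proof.
apply: dlift_lin => n; apply: lin_comp; first exact: din_lin.
exact: tpow_act_lin.
Qed.

Lemma T_act_din h n (v : Tn n) : act (M := T) h (din v) = din (act (M := Tn n) h v).
Proof.
rewrite /= dlift_din // => m.
by rewrite (lin0 (@tpow_act_lin m h)) (lin0 (@din_lin _ _ m)).
Qed.

Lemma T_coact_lin : linear (@coact k H T).
Proof.
apply: dlift_lin => n; apply: lin_comp; last exact: tpow_coact_lin.
by apply: tmap_lin => //; apply: din_lin.
Qed.

Lemma T_coact_din n (v : Tn n) :
  coact (M := T) (din v) = tmap id (@din) (coact (M := Tn n) v).
Proof.
rewrite /= dlift_din // => m; rewrite (lin0 (@tpow_coact_lin m)).
by apply: lin0; apply: tmap_lin => //; apply: din_lin.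
Qed.

Lemma tcat_bilin i j : bilin (@tcat k H L i j).
Proof. by elim: j => [|j IH] /=; [exact: pure_bilin|lin]. Qed.

Lemma ttwist_lin j : linear (@ttwist k H L j).
Proof.
elim: j => [//|j IH]; apply: tmap_lin => //; exact: haut_lin.
Qed.

Lemma tprod_bilin i j : bilin (@tprod k H L i j).
Proof.
have hl n := @tpow_haut_lin n; have dl n := @din_lin k Tn n.
have iter_lin m n : linear (iter m (haut (Tn n))).
  by elim: m => [//|m IH]; exact: (lin_comp (hl n) IH).
have tl m := @ttwist_lin m; have cb m n := tcat_bilin m n.
case: i j => [|i] [|j].
- change (bilin (fun c y : k^o => din (c *: y : Tn 0))); lin.
- change (bilin (fun (c : k^o) (y : Tn j.+1) => din (c *: haut (Tn j.+1) y))); lin.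
- change (bilin (fun (x : Tn i.+1) (c : k^o) => din (c *: haut (Tn i.+1) x))); lin.
- change (bilin (fun (x : Tn i.+1) (y : Tn j.+1) =>
    din (tcat (iter j (haut (Tn i.+1)) x) (ttwist y) : Tn (j.+1 + i.+1)))); lin.
Qed.

Lemma T_mul_bilin : bilin (@T_mul k H L).
Proof.
rewrite /T_mul; apply: bilinP => [y|x].
  apply: dlift_lin => i; apply: dlift_linr => j w.
  exact: (tprod_bilin i j).1.
apply: dlift_linr => i v; apply: dlift_lin => j.
exact: (tprod_bilin i j).2.
Qed.

Lemma T_mul_din i j (v : Tn i) (w : Tn j) :
  T_mul (din v : T) (din w : T) = tprod v w.
Proof.
rewrite /T_mul dlift_din => [|n].
  by rewrite dlift_din // => m; rewrite (lin0 ((tprod_bilin i m).2 v)).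
rewrite dlift_din => [|m]; first by rewrite (lin0 ((tprod_bilin n j).1 w)).
by rewrite (lin0 ((tprod_bilin n m).2 0)).
Qed.

Lemma T_mulr1 x : T_mul x one = haut T x.
Proof.
move: x; apply: lin_dsum => [||n v]; first exact: (T_mul_bilin.1 _).
  exact: T_haut_lin.
rewrite T_mul_din T_haut_din; case: n v => [|n] v /=.
  by congr Defs.din; rewrite /= /GRing.scale /= mulr1.
by rewrite scale1r.
Qed.

Lemma T_mul1r x : T_mul one x = haut T x.
Proof.
move: x; apply: lin_dsum => [||n v]; first exact: (T_mul_bilin.2 _).
  exact: T_haut_lin.
by rewrite T_mul_din T_haut_din /= scale1r.
Qed.

End TensorAlgebra.

(** * The quotient [U(L)]: induced operations, generators and relations *)

Section Enveloping.
Variables (k : fieldType) (H : homHopf k) (L : homLie H).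
Hypotheses (hopfH : is_homHopf H).
Hypotheses (hydL : is_hyd L) (invL : involutive (haut L)).

Local Notation T := (T_obj L).
Local Notation U := (U_obj L).
Local Notation I := (@U_ideal k H L).
Local Notation proj := (@U_proj k H L).

Let hTl := T_haut_lin hydL.
Let Tb := T_mul_bilin hydL.

Lemma U_idealP u : reflect (forall P : submodClosed T,
    is_HHomIdeal (@T_mul k H L) P -> (forall x y, U_rel x y \in P) -> u \in P)
  (u \in I).
Proof. exact: asboolP. Qed.

Lemma U_ideal_rel x y : U_rel x y \in I.
Proof. by apply/U_idealP. Qed.

Lemma U_ideal_act h u : u \in I -> act (M := T) h u \in I.
Proof.
move=> /U_idealP hu; apply/U_idealP => P idP relP; have [hP _ _ _ _] := idP.
exact/hP/hu.
Qed.

Lemma U_ideal_haut u : u \in I -> haut T u \in I.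
Proof.
move=> /U_idealP hu; apply/U_idealP => P idP relP; have [_ _ hP _ _] := idP.
exact/hP/hu.
Qed.

(* The ideal axioms only mention triple products, but x u = x (β(u) 1) and
   u x = (1 β(u)) x since β is involutive. *)
Lemma U_ideal_mull x u : u \in I -> T_mul x u \in I.
Proof.
move=> /U_ideal_haut/U_idealP hu; apply/U_idealP => P idP relP.
have [_ _ _ _ hP] := idP; apply: hP.
exists [:: (x, T_mul (haut T u) (T_one L))]; split=> [_ /[1!inE] /eqP -> /=|].
  split=> //; exists [:: (haut T u, T_one L)]; rewrite big_seq1.
  by split=> // _ /[1!inE] /eqP ->; split=> //; apply: hu.
by rewrite big_seq1 /= T_mulr1 // T_haut_inv.
Qed.

Lemma U_ideal_mulr x u : u \in I -> T_mul u x \in I.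
Proof.
move=> /U_ideal_haut/U_idealP hu; apply/U_idealP => P idP relP.
have [_ _ _ assP hP] := idP; apply: hP; apply/assP.
exists [:: (T_mul (T_one L) (haut T u), x)]; split=> [_ /[1!inE] /eqP -> /=|].
  split=> //; exists [:: (T_one L, haut T u)]; rewrite big_seq1.
  by split=> // _ /[1!inE] /eqP ->; split=> //; apply: hu.
by rewrite big_seq1 /= T_mul1r // T_haut_inv.
Qed.

Lemma U_proj_lin : linear proj.
Proof. exact: qproj_linear. Qed.

Lemma U_proj_eq0 u : u \in I -> proj u = 0.
Proof.
move=> uI; rewrite -(lin0 U_proj_lin); apply/(qprojP I); by rewrite subr0.
Qed.

Lemma U_proj_repr u : proj (repr u) = u.
Proof. exact: (qproj_surj (P := I)). Qed.

(** [repr (proj t)] and [t] differ by an element of the ideal. This makes every operation of [U(L)],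
    computed on representatives, agree with the one on [T(L)]. *)
Lemma repr_U_proj (W : lmodType k) (F : T -> W) : linear F ->
  (forall u, u \in I -> F u = 0) -> forall t, F (repr (proj t)) = F t.
Proof.
move=> Fl F0 t; apply/eqP; rewrite -subr_eq0 -(linB Fl); apply/eqP/F0.
by apply/(qprojP I); apply: U_proj_repr.
Qed.

(* H ⊗ I is the intersection of the H ⊗ P over the ideals P defining I,
   because functionals on H separate tensors. *)
Lemma U_ideal_coact u : u \in I -> tmap id proj (coact (M := T) u) = 0.
Proof.
move=> /U_idealP hu; have pl := U_proj_lin.
apply: tens_sep => phi phil; rewrite sw_tmap //; last by lin.
transitivity (proj (\sw_(h, t <- coact (M := T) u) ((phi h : k) *: t))).
  by rewrite (lin_sw (g := proj)) //; apply: eq_sw => h t; rewrite (linZ pl).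
apply: U_proj_eq0; apply/U_idealP => P idP relP.
have [_ /(_ u (hu P idP relP)) [s [sP ->]] _ _ _] := idP.
have fb : bilin (fun (h : H) (t : T) => (phi h : k) *: t) by lin.
rewrite (lin_sum (sw_linear fb)) big_seq.
by apply: rpred_sum => p /sP pP; rewrite swE // rpredZ.
Qed.

Lemma U_haut_proj t : haut U (proj t) = proj (haut T t).
Proof.
have pl := U_proj_lin.
apply: (repr_U_proj (F := fun t => proj (haut T t))); first by lin.
by move=> u uI; apply/U_proj_eq0/U_ideal_haut.
Qed.

Lemma U_act_proj h t : act (M := U) h (proj t) = proj (act (M := T) h t).
Proof.
have pl := U_proj_lin; have al := T_act_lin hydL h.
apply: (repr_U_proj (F := fun t => proj (act (M := T) h t))); first by lin.
by move=> u uI; apply/U_proj_eq0/U_ideal_act.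
Qed.

Lemma U_coact_proj t : coact (M := U) (proj t) = tmap id proj (coact (M := T) t).
Proof.
have pl := U_proj_lin; have cl := T_coact_lin hopfH hydL.
have tl : linear (tmap (V := H) id proj) by apply: tmap_lin.
apply: (repr_U_proj (F := fun t => tmap id proj (coact (M := T) t))).
  by lin.
exact: U_ideal_coact.
Qed.

Lemma U_mul_proj s t : U_mul (proj s) (proj t) = proj (T_mul s t).
Proof.
have pl := U_proj_lin; rewrite /U_mul.
rewrite (repr_U_proj (F := fun u => proj (T_mul u (repr (proj t))))).
- apply: (repr_U_proj (F := fun u => proj (T_mul s u))); first by lin.
  by move=> u uI; apply/U_proj_eq0/U_ideal_mull.
- by lin.
- by move=> u uI; apply/U_proj_eq0/U_ideal_mulr.
Qed.

Lemma U_haut_inv : involutive (haut U).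
Proof. by move=> u; rewrite -[u]U_proj_repr !U_haut_proj T_haut_inv. Qed.

Lemma U_incl_lin : linear (@U_incl k H L).
Proof.
have pl := U_proj_lin; have dl := @din_lin k (tpow L) 1.
by rewrite /U_incl /T_incl; lin.
Qed.

Lemma U_act_incl (h : H) (l : L) : act h (U_incl l : U) = U_incl (act h l).
Proof. by rewrite U_act_proj T_act_din. Qed.

Lemma U_haut_incl (l : L) : haut U (U_incl l) = U_incl (haut L l).
Proof. by rewrite U_haut_proj T_haut_din. Qed.

Lemma U_coact_incl (l : L) : coact (U_incl l : U) = tmap id (@U_incl k H L) (coact l).
Proof.
have pl := U_proj_lin; have dl := @din_lin k (tpow L) 1.
have tl : linear (tmap (V := H) id proj) by apply: tmap_lin.
rewrite U_coact_proj T_coact_din // {2}/tmap lin_sw //.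
by apply: eq_sw => h m; rewrite tmapE.
Qed.

(** Induction on tensor degree: [v ⊗ l] is exactly the product of [v] and [l], as [⊙] introduces no
    twist when the right factor has degree 1. *)
Lemma U_gen (Q : U -> Prop) :
  (forall c u v, Q u -> Q v -> Q (c *: u + v)) -> Q (U_one L) ->
  (forall a (l : L), Q a -> Q (U_mul a (U_incl l))) -> forall a, Q a.
Proof.
move=> QD Q1 QM a.
have Q0 : Q 0 by rewrite -[0](addNr (U_one L)) -scaleN1r; apply: QD.
have QS J (r : seq J) F : (forall i, Q (F i)) -> Q (\sum_(i <- r) F i).
  move=> QF; elim: r => [|i r IH]; first by rewrite big_nil.
  by rewrite big_cons -[F i]scale1r; apply: QD.
have pl := U_proj_lin; have dl n := @din_lin k (tpow L) n.
suff Qdin n (v : tpow L n) : Q (proj (din v)).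
  rewrite -[a]U_proj_repr; have [N ->] := dsum_din (repr a : T).
  by rewrite (lin_sum pl); apply: QS => n; apply: Qdin.
elim: n v => [|[_|n IH]] v.
- have -> : (v : k^o) = v *: (1 : k^o) by rewrite /GRing.scale /= mulr1.
  rewrite (linZ (dl 0)) (linZ pl) -[_ *: _]addr0; exact: QD.
(* In degree 1, [v] is the product of [1] and [β(v)], since multiplying by the unit applies [β]. *)
- rewrite -[v]invL -[din _]/(T_incl _) -[T_incl _]T_haut_inv //.
  rewrite [haut T (T_incl _)]T_haut_din // invL.
  by rewrite -T_mul1r // -U_mul_proj; apply: QM.
- rewrite (tens_sum v) (lin_sw (g := fun w => proj (din w))); last by lin.
  apply: QS => p; have := QM _ p.2 (IH p.1).
  by rewrite U_mul_proj T_mul_din.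
Qed.

(** The generator [U_rel x y] vanishes in the quotient, and degree-two pure tensors are products of
    elements of degree one. *)
Lemma U_mul_incl (x y : L) : U_mul (U_incl x) (U_incl y)
  = (\sw_(h, p <- coact x) U_mul (U_incl (act h (haut L y))) (U_incl (haut L p)))
    + U_incl (bracket x y).
Proof.
have pl := U_proj_lin; have dl n := @din_lin k (tpow L) n.
have := U_proj_eq0 (U_ideal_rel x y).
rewrite /U_rel (linB (dl 2)) !(linB pl) => /eqP.
rewrite subr_eq0 subr_eq => /eqP e; rewrite U_mul_proj T_mul_din // [LHS]e addrC.
congr (_ + _).
rewrite (lin_sw (g := fun w => proj (din w))); last by lin.
by apply: eq_sw => h p; rewrite U_mul_proj T_mul_din.
Qed.

End Enveloping.

(** * Cocommutativity of the enveloping algebra *)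

Theorem corollary4p6 (k : fieldType) (H : homHopf k) (L : homLie H)
  (hopfH : is_homHopf H) (invH : involutive (haut H))
  (lieL : is_homLie L) (invL : involutive (haut L))
  (Delta : U_obj L -> U_obj L ⊗ U_obj L) (eps : U_obj L -> k)
  (S : U_obj L -> U_obj L)
  (hopfU : is_hydHopf (@U_mul k H L) (U_one L) Delta eps S)
  (Delta1 : Delta (U_one L) = U_one L ⊗ U_one L)
  (DeltaL : forall l : L, Delta (U_incl l) =
     haut (U_obj L) (U_incl l) ⊗ U_one L + U_one L ⊗ haut (U_obj L) (U_incl l))
  (eps1 : eps (U_one L) = 1)
  (epsL : forall l : L, eps (U_incl l) = 0)
  (SL : forall l : L, S (U_incl l) = - U_incl l)
  (SM : forall x y : U_obj L, S (U_mul x y) =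
     \sw_(x1, x0 <- coact x)
       U_mul (act x1 (S (hautV (U_obj L) y))) (S (haut (U_obj L) x0))) :
  H_cocommutative Delta.
Proof.
have hydL : is_hyd L by case: lieL.
have [algU [[[Dl _] _ _ _ _] _ _] [DM _ _ _] _] := hopfU.
apply: (comul_cocommutative hopfH invH algU (U_haut_inv hydL invL) hydL invL
  (iota := @U_incl k H L)) => //.
- exact: U_incl_lin.
- exact: U_act_incl.
- exact: U_haut_incl.
- exact: U_coact_incl.
- exact: U_gen.
- exact: U_mul_incl.
Qed.
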